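(* Let $\{A(t,\varphi): t\in\mathbb R,\varphi\in E\}$ be a family of m-dissipative operators in $X$, and suppose that either (i) $A$ satisfies the uniformly continuous control condition with data $(h,k,K_0,L_1,L_2)$ and $K_0<-\omega$, or (ii) $A$ satisfies the Lipschitz control condition with data $(g,h,k,K_0,L_1,L_2)$ and $\max\{K_0,L_g\}<-\omega$, where $L_g$ is the Lipschitz constant of $g$. Then there exists a bounded and uniformly continuous solution $u:\mathbb R\to X$ of $$u'(t)\in A(t,u_t)u(t)+\omega u(t),\quad t\in\mathbb R.$$
   Context: $X$ is a Banach space, $\omega\in\mathbb R$, $\mathbb R^+=[0,\infty)$. $BUC(J,X)$ denotes the bounded uniformly continuous functions $J\to X$ with the sup norm. Either (infinite delay) $\mathbb I=(-\infty,0]$ and $E=BUC((-\infty,0],X)$, or (finite delay) $\mathbb I=[-r,0]$ for some $r>0$ and $E=C([-r,0],X)$; $E$ carries the sup norm $\|\cdot\|_E$. For $u\in BUC(\mathbb R,X)$ and $t\in\mathbb R$, $u_t\in E$ is $u_t(s)=u(t+s)$, $s\in\mathbb I$. The operators $A(t,\varphi)\subset X\times X$ may be multivalued, with domain depending on $(t,\varphi)$; m-dissipative means dissipative with $R(I-\lambda A(t,\varphi))=X$ for all $\lambda>0$. Uniformly continuous control condition with data $(h,k,K_0,L_1,L_2)$: $h,k:\mathbb R\to X$ are bounded and uniformly continuous, $K_0>0$, $L_1,L_2:\mathbb R^+\to\mathbb R^+$ are continuous and non-decreasing, and for all $\lambda>0$, $t_1,t_2\in\mathbb R$, $\varphi_1,\varphi_2\in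 E$, $[x_i,y_i]\in A(t_i,\varphi_i)$ ($i=1,2$), $$\|x_1-x_2\|\le\|x_1-x_2-\lambda(y_1-y_2)\|+\lambda\|h(t_1)-h(t_2)\|L_1(\|x_2\|)+\lambda\|k(t_1)-k(t_2)\|L_2(\|\varphi_2\|_E)+K_0\lambda\|\varphi_1-\varphi_2\|_E.$$ Lipschitz control condition with data $(g,h,k,K_0,L_1,L_2)$: $g,h,k:\mathbb R\to X$ are bounded and Lipschitz continuous, $K_0>0$, $L_1,L_2:\mathbb R^+\to\mathbb R^+$ are continuous and non-decreasing, and for all $\lambda>0$, $t_1,t_2\in\mathbb R$, $\varphi_1,\varphi_2\in E$, $[x_i,y_i]\in A(t_i,\varphi_i)$ ($i=1,2$), $$\|x_1-x_2\|\le\|x_1-x_2-\lambda(y_1-y_2)\|+\lambda\|h(t_1)-h(t_2)\|L_1(\|x_2\|)+\lambda\|g(t_1)-g(t_2)\|\,\|y_2\|+\lambda\|k(t_1)-k(t_2)\|L_2(\|\varphi_2\|_E)+K_0\lambda\|\varphi_1-\varphi_2\|_E.$$ Yosida approximation of the derivative: for $\lambda>0$ and $u\in BUC(\mathbb R,X)$, $(\partial_t)_\lambda u(t)=\frac1\lambda\Big(u(t)-\frac1\lambda\int_0^\infty e^{-\tau/\lambda}u(t-\tau)\,d\tau\Big)$. Recursion started at $\psi\in BUC(\mathbb R,X)$: for $\lambda>0$, $u_{1,\lambda}\in BUC(\mathbb R,X)$ is the (unique) solution of $(\partial_t)_\lambda u_{1,\lambda}(t)\in A(t,\psi_t)u_{1,\lambda}(t)+\omega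 u_{1,\lambda}(t)$, $t\in\mathbb R$; given $u_{n,\lambda}$, $u_{n+1,\lambda}\in BUC(\mathbb R,X)$ is the (unique) solution of $(\partial_t)_\lambda u_{n+1,\lambda}(t)\in A(t,(u_{n,\lambda})_t)u_{n+1,\lambda}(t)+\omega u_{n+1,\lambda}(t)$, $t\in\mathbb R$. Solution: $u:\mathbb R\to X$ is called the solution of $u'(t)\in A(t,u_t)u(t)+\omega u(t)$, $t\in\mathbb R$, if for every starting point $\psi\in BUC(\mathbb R,X)$ one has $u=\lim_{n\to\infty}\lim_{\lambda\to0+}u_{n,\lambda}$, both limits existing uniformly on $\mathbb R$. *)

(* Defs.v *)
From Stdlib Require Import Reals.
From Coquelicot Require Import Coquelicot.

Open Scope R_scope.

(* A Banach space is a [CompleteNormedModule R_AbsRing]. *)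

Section FunctionSpaces.
Context {X : NormedModule R_AbsRing}.

(* Functions are defined on a type [T] of reals, embedded by [pos : T -> R]:
   the identity for [T = R], [proj1_sig] for a subset of [R]. *)

Definition bounded_fun {T : Type} (f : T -> X) : Prop :=
  exists M : R, forall s, norm (f s) <= M.

Definition continuous_fun {T : Type} (pos : T -> R) (f : T -> X) : Prop :=
  forall s eps, 0 < eps ->
    exists delta, 0 < delta /\
      forall s', Rabs (pos s' - pos s) < delta -> norm (minus (f s') (f s)) < eps.

Definition unif_continuous_fun {T : Type} (pos : T -> R) (f : T -> X) : Prop :=
  forall eps, 0 < eps ->
    exists delta, 0 < delta /\
      forall s s', Rabs (pos s' - pos s) < delta -> norm (minus (f s') (f s)) < eps.

Definition is_BUC {T : Type} (pos : T -> R) (f : T -> X) : Prop :=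
  bounded_fun f /\ unif_continuous_fun pos f.

Definition sup_norm {T : Type} (f : T -> X) : R :=
  real (Lub_Rbar (fun r => exists s, r = norm (f s))).

Definition lipschitz (f : R -> X) : Prop :=
  exists L : R, forall s t, norm (minus (f s) (f t)) <= L * Rabs (s - t).

(* The least Lipschitz constant; only meaningful when [lipschitz f] holds. *)
Definition lip_const (f : R -> X) : R :=
  real (Lub_Rbar (fun q => exists s t,
    s <> t /\ q = norm (minus (f s) (f t)) / Rabs (s - t))).

End FunctionSpaces.

Record BUC (X : NormedModule R_AbsRing) : Type := mkBUC {
  BUC_fun :> R -> X;
  BUC_prop : is_BUC (fun t : R => t) BUC_fun
}.

Inductive delay : Type :=
  | infinite_delay
  | finite_delay (r : posreal).

Definition delay_interval (d : delay) (s : R) : Prop :=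
  match d with
  | infinite_delay => s <= 0
  | finite_delay r => - r <= s <= 0
  end.

Definition delay_dom (d : delay) : Type := {s : R | delay_interval d s}.

Definition delay_pos {d : delay} (s : delay_dom d) : R := proj1_sig s.

Definition is_history {X : NormedModule R_AbsRing} {d : delay}
    (phi : delay_dom d -> X) : Prop :=
  match d with
  | infinite_delay => is_BUC delay_pos phi
  | finite_delay _ => continuous_fun delay_pos phi
  end.

(* The space E. *)
Record history (X : NormedModule R_AbsRing) (d : delay) : Type := mkHistory {
  history_fun :> delay_dom d -> X;
  history_prop : is_history history_fun
}.

Definition hnorm {X : NormedModule R_AbsRing} {d : delay} (phi : history X d) : R :=
  sup_norm (fun s => phi s).

Definition hdist {X : NormedModule R_AbsRing} {d : delay}
    (phi1 phi2 : history X d) : R :=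
  sup_norm (fun s => minus (phi1 s) (phi2 s)).

Definition segment_fun {X : NormedModule R_AbsRing} (d : delay) (u : R -> X) (t : R) :
    delay_dom d -> X :=
  fun s => u (t + delay_pos s).

Lemma segment_is_history {X : NormedModule R_AbsRing} (d : delay) (u : BUC X) (t : R) :
  is_history (segment_fun d u t).
Proof.
destruct u as [u [[M HM] Hu]]; simpl.
assert (Huc : unif_continuous_fun delay_pos (segment_fun d u t)).
{ intros eps Heps. destruct (Hu eps Heps) as [delta [Hd H]].
  exists delta; split; [exact Hd|]. intros s s' Hs. apply H.
  replace (t + delay_pos s' - (t + delay_pos s))
    with (delay_pos s' - delay_pos s) by ring.
  exact Hs. }
destruct d as [|r]; simpl.
- split; [|exact Huc]. exists M; intros s; apply HM.
- intros s eps Heps. destruct (Huc eps Heps) as [delta [Hd H]].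
  exists delta; split; [exact Hd|]. intros s'; apply H.
Qed.

Definition segment {X : NormedModule R_AbsRing} (d : delay) (u : BUC X) (t : R) :
    history X d :=
  mkHistory X d (segment_fun d u t) (segment_is_history d u t).

(* A multivalued operator in X is its graph: [B x y] means [x, y] is in B. *)
Definition mop (X : Type) : Type := X -> X -> Prop.

Definition dissipative {X : NormedModule R_AbsRing} (B : mop X) : Prop :=
  forall lambda x1 y1 x2 y2, 0 < lambda -> B x1 y1 -> B x2 y2 ->
    norm (minus x1 x2) <= norm (minus (minus x1 x2) (scal lambda (minus y1 y2))).

Definition m_dissipative {X : NormedModule R_AbsRing} (B : mop X) : Prop :=
  dissipative B /\
  forall lambda, 0 < lambda ->
    forall z, exists x y, B x y /\ minus x (scal lambda y) = z.

(* Continuous non-decreasing maps from [0,oo) to [0,oo); values at negative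
   arguments are irrelevant. *)
Definition growth_fun (L : R -> R) : Prop :=
  (forall a, 0 <= a -> 0 <= L a) /\
  continuous_on (fun a => 0 <= a) L /\
  (forall a b, 0 <= a -> a <= b -> L a <= L b).

Section ControlConditions.
Context {X : NormedModule R_AbsRing} {d : delay}.
Variable A : R -> history X d -> mop X.

Definition uc_control (h k : R -> X) (K0 : R) (L1 L2 : R -> R) : Prop :=
  is_BUC (fun t : R => t) h /\ is_BUC (fun t : R => t) k /\ 0 < K0 /\
  growth_fun L1 /\ growth_fun L2 /\
  forall lambda t1 t2 (phi1 phi2 : history X d) x1 y1 x2 y2,
    0 < lambda -> A t1 phi1 x1 y1 -> A t2 phi2 x2 y2 ->
    norm (minus x1 x2) <=
      norm (minus (minus x1 x2) (scal lambda (minus y1 y2)))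
      + lambda * norm (minus (h t1) (h t2)) * L1 (norm x2)
      + lambda * norm (minus (k t1) (k t2)) * L2 (hnorm phi2)
      + K0 * lambda * hdist phi1 phi2.

Definition lip_control (g h k : R -> X) (K0 : R) (L1 L2 : R -> R) : Prop :=
  (bounded_fun g /\ lipschitz g) /\
  (bounded_fun h /\ lipschitz h) /\
  (bounded_fun k /\ lipschitz k) /\ 0 < K0 /\
  growth_fun L1 /\ growth_fun L2 /\
  forall lambda t1 t2 (phi1 phi2 : history X d) x1 y1 x2 y2,
    0 < lambda -> A t1 phi1 x1 y1 -> A t2 phi2 x2 y2 ->
    norm (minus x1 x2) <=
      norm (minus (minus x1 x2) (scal lambda (minus y1 y2)))
      + lambda * norm (minus (h t1) (h t2)) * L1 (norm x2)
      + lambda * norm (minus (g t1) (g t2)) * norm y2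
      + lambda * norm (minus (k t1) (k t2)) * L2 (hnorm phi2)
      + K0 * lambda * hdist phi1 phi2.

End ControlConditions.

(* The integrand is continuous and exponentially decaying, so the improper
   Riemann integral is the Bochner integral. *)
Definition yosida_deriv {X : CompleteNormedModule R_AbsRing} (lambda : R)
    (u : R -> X) (t : R) : X :=
  scal (/ lambda)
    (minus (u t)
       (scal (/ lambda)
          (RInt_gen (fun tau => scal (exp (- tau / lambda)) (u (t - tau)))
             (at_point 0) (Rbar_locally p_infty)))).

Section Solutions.
Context {X : CompleteNormedModule R_AbsRing} {d : delay}.
Variable A : R -> history X d -> mop X.
Variable omega : R.

(* (d_t)_lambda w (t) belongs to A(t, v_t) w(t) + omega w(t) for all t. *)
Definition solves_approx (lambda : R) (v w : BUC X) : Prop :=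
  forall t, exists y, A t (segment d v t) (w t) y /\
    yosida_deriv lambda w t = plus y (scal omega (w t)).

Definition unique_solves_approx (lambda : R) (v w : BUC X) : Prop :=
  solves_approx lambda v w /\
  forall w' : BUC X, solves_approx lambda v w' -> forall t, w' t = w t.

(* [un n lambda] is u_{n,lambda}, with the convention u_{0,lambda} = psi. *)
Definition approx_scheme (psi : BUC X) (un : nat -> R -> BUC X) : Prop :=
  forall lambda, 0 < lambda ->
    un O lambda = psi /\
    forall n, unique_solves_approx lambda (un n lambda) (un (S n) lambda).

Definition unif_lim {I : Type} (F : (I -> Prop) -> Prop)
    (f : I -> R -> X) (l : R -> X) : Prop :=
  forall eps, 0 < eps -> F (fun i => forall t, norm (minus (f i t) (l t)) < eps).

Definition is_solution (u : R -> X) : Prop :=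
  forall psi : BUC X,
    exists un : nat -> R -> BUC X, approx_scheme psi un /\
    exists U : nat -> R -> X,
      (forall n, unif_lim (at_right 0) (fun lambda => BUC_fun X (un n lambda)) (U n)) /\
      unif_lim eventually U u.

End Solutions.

(* Main.v *)
(* With [al := - omega > K0], the uniformly continuous condition is the Lipschitz one
   with [g = 0].  For fixed [v], the approximate equation says that [w t] is the
   resolvent of [A (t, v_t)] applied to a multiple [q < 1] of the exponential average of
   the past of [w]; resolvents are nonexpansive, so there is a unique bounded solution
   [w_lam v], and [w_lam v] is [K0 / al]-Lipschitz in [v], uniformly in [lam].  To let
   [lam] tend to 0 one doubles the time variable: [phi (s, t) = |w_lam s - w_mu t|]
   satisfies
     [(d_s)_lam phi + (d_t)_mu phi + al phi <= eps + C (s - t)^2],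
   and comparison with [a + b (s - t)^2] bounds [phi (t, t)] by a multiple of
   [eps + lam + mu].  When [g <> 0] this needs bounded slopes, which holds for Lipschitz
   [v] because [L_g < al]; Lipschitz functions are dense.  The limit [S v] is a
   contraction in [v], its fixed point is the solution, and [u_n = S^n psi]. *)

Require Import Defs.
From Stdlib Require Import Reals Lra Lia List ClassicalEpsilon.
From Coquelicot Require Import Coquelicot.
Open Scope R_scope.

(** * Linear identities in modules *)

(** Comparison means an argument on suprema: the functions live on the whole line or plane, where a
    maximum need not exist. A bound [M] fed into the control inequality comes back as [q * M + c]
    with [q < 1], whence the bound [c / (1 - q)]. The step of the control inequality is matched each
    time to the equation, so that only differences involving averages remain.

    A quadratic suits the doubling because shifting either variable produces only first and second
    moments: the first-order terms of the two variables cancel, and the second-order ones have size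
    [lam + mu]. The obstacle is the [g] term, which multiplies the slope of one solution, a quantity
    that may blow up as its parameter tends to 0. Slope bounds need not survive a uniform limit of
    [v], so density is applied to the Cauchy property instead; it survives because solutions depend
    on [v] with a constant free of [lam]. The same constant lets the limit in [lam] pass through [n]
    nested solution maps. *)

Inductive lin_expr : Type :=
  | LVar (n : nat)
  | LZero
  | LPlus (a b : lin_expr)
  | LOpp (a : lin_expr)
  | LScal (c : R) (a : lin_expr).

Fixpoint lin_eval {V : ModuleSpace R_Ring} (env : list V) (e : lin_expr) : V :=
  match e with
  | LVar n => nth n env zero
  | LZero => zero
  | LPlus a b => plus (lin_eval env a) (lin_eval env b)
  | LOpp a => opp (lin_eval env a)
  | LScal c a => scal c (lin_eval env a)
  end.

Fixpoint lin_coef (e : lin_expr) (i : nat) : R :=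
  match e with
  | LVar n => if Nat.eqb n i then 1 else 0
  | LZero => 0
  | LPlus a b => lin_coef a i + lin_coef b i
  | LOpp a => - lin_coef a i
  | LScal c a => c * lin_coef a i
  end.

Fixpoint lin_comb {V : ModuleSpace R_Ring} (c : nat -> R) (env : list V) : V :=
  match env with
  | nil => zero
  | x :: env' => plus (scal (c O) x) (lin_comb (fun i => c (S i)) env')
  end.

Lemma lin_comb_ext {V : ModuleSpace R_Ring} (c c' : nat -> R) (env : list V) :
  (forall i, c i = c' i) -> lin_comb c env = lin_comb c' env.
Proof.
  revert c c'; induction env as [|x env IH]; intros c c' H; simpl; [reflexivity|].
  rewrite (H O); f_equal; apply IH; intros i; apply H.
Qed.

Lemma lin_comb_zero {V : ModuleSpace R_Ring} (env : list V) :
  lin_comb (fun _ => 0) env = zero.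
Proof.
  induction env as [|x env IH]; simpl; [reflexivity|].
  rewrite IH, plus_zero_r. apply (scal_zero_l x).
Qed.

Lemma lin_comb_var {V : ModuleSpace R_Ring} (n : nat) (env : list V) :
  lin_comb (fun i => if Nat.eqb n i then 1 else 0) env = nth n env zero.
Proof.
  revert n; induction env as [|x env IH]; intros [|n]; simpl; try reflexivity.
  - rewrite lin_comb_zero, plus_zero_r. apply (scal_one x).
  - rewrite IH. transitivity (plus zero (nth n env zero)).
    + f_equal. apply (scal_zero_l x).
    + apply plus_zero_l.
Qed.

Lemma lin_comb_plus {V : ModuleSpace R_Ring} (c c' : nat -> R) (env : list V) :
  lin_comb (fun i => c i + c' i) env = plus (lin_comb c env) (lin_comb c' env).
Proof.
  revert c c'; induction env as [|x env IH]; intros c c'; simpl.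
  - symmetry; apply plus_zero_l.
  - rewrite (IH (fun i => c (S i)) (fun i => c' (S i))).
    change (c O + c' O) with (plus (c O : R_Ring) (c' O)). rewrite scal_distr_r.
    rewrite <- !plus_assoc. f_equal.
    rewrite !plus_assoc. f_equal. apply plus_comm.
Qed.

Lemma lin_comb_scal {V : ModuleSpace R_Ring} (k : R) (c : nat -> R) (env : list V) :
  lin_comb (fun i => k * c i) env = scal k (lin_comb c env).
Proof.
  revert c; induction env as [|x env IH]; intros c; simpl.
  - symmetry; apply (scal_zero_r (V := V)).
  - rewrite (IH (fun i => c (S i))).
    rewrite scal_distr_l, scal_assoc. reflexivity.
Qed.

(** Correctness of the reflection: expressions with equal coefficients agree in every module, so a
    vector identity reduces to scalar ones, with inverse step sizes left to [field]. *)
Lemma lin_eval_comb {V : ModuleSpace R_Ring} (env : list V) (e : lin_expr) :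
  lin_eval env e = lin_comb (lin_coef e) env.
Proof.
  induction e as [n| |a IHa b IHb|a IHa|c a IHa]; simpl.
  - symmetry; apply lin_comb_var.
  - symmetry; apply lin_comb_zero.
  - rewrite IHa, IHb; symmetry; apply lin_comb_plus.
  - rewrite IHa. rewrite <- (scal_opp_one (K := R_Ring) (lin_comb (lin_coef a) env)).
    change (opp one : R_Ring) with (-1).
    rewrite <- lin_comb_scal. apply lin_comb_ext; intros i; ring.
  - rewrite IHa; symmetry; apply lin_comb_scal.
Qed.

Ltac lin_mem x l :=
  lazymatch l with
  | nil => constr:(false)
  | x :: _ => constr:(true)
  | _ :: ?l' => lin_mem x l'
  end.

Ltac lin_index x l :=
  lazymatch l with
  | x :: _ => constr:(O)
  | _ :: ?l' => let n := lin_index x l' in constr:(S n)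
  end.

Ltac lin_atoms e l :=
  lazymatch e with
  | plus ?a ?b => let l' := lin_atoms a l in lin_atoms b l'
  | minus ?a ?b => let l' := lin_atoms a l in lin_atoms b l'
  | opp ?a => lin_atoms a l
  | scal _ ?a => lin_atoms a l
  | zero => l
  | _ => lazymatch lin_mem e l with true => l | false => constr:(e :: l) end
  end.

Ltac lin_reify e l :=
  lazymatch e with
  | plus ?a ?b =>
      let a' := lin_reify a l in let b' := lin_reify b l in constr:(LPlus a' b')
  | minus ?a ?b =>
      let a' := lin_reify a l in let b' := lin_reify b l in constr:(LPlus a' (LOpp b'))
  | opp ?a => let a' := lin_reify a l in constr:(LOpp a')
  | scal ?k ?a => let a' := lin_reify a l in constr:(LScal k a')
  | zero => constr:(LZero)
  | _ => let n := lin_index e l in constr:(LVar n)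
  end.

(* Reduces a linear identity in a module over [R] to one scalar identity per
   atom, and discharges these by [field]. *)
Ltac module_eq :=
  lazymatch goal with
  | |- @eq ?T ?a ?b =>
    let l0 := lin_atoms a constr:(@nil T) in
    let l := lin_atoms b l0 in
    let a' := lin_reify a l in
    let b' := lin_reify b l in
    change (lin_eval l a' = lin_eval l b');
    rewrite !lin_eval_comb;
    cbv [lin_comb lin_coef Nat.eqb];
    repeat (apply f_equal2; [apply f_equal2; [|reflexivity]|]);
    try reflexivity;
    lazymatch goal with
    | |- @eq _ ?u ?v => change (@eq R u v); try first [ring | field; auto with real]
    end
  end.

(** * The norm distance *)

Definition ndist {X : CompleteNormedModule R_AbsRing} (x y : X) : R := norm (minus x y).

Section Norms.
Context {X : CompleteNormedModule R_AbsRing}.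

Lemma norm_nonneg (x : X) : 0 <= norm x.
Proof. exact (norm_ge_0 x). Qed.

Lemma norm_scal_le (c : R) (x : X) : norm (scal c x) <= Rabs c * norm x.
Proof. exact (norm_scal c x). Qed.

Lemma norm_plus_le (x y : X) : norm (plus x y) <= norm x + norm y.
Proof. exact (norm_triangle x y). Qed.

Lemma norm_eq_le (x y : X) (c : R) : x = y -> norm y <= c -> norm x <= c.
Proof. intros ->; trivial. Qed.

Lemma norm_scal_pos (c : R) (x : X) : 0 <= c -> norm (scal c x) <= c * norm x.
Proof.
  intros Hc. rewrite <- (Rabs_pos_eq c Hc) at 2. apply norm_scal_le.
Qed.

Lemma ndist_sym (x y : X) : ndist x y = ndist y x.
Proof.
  unfold ndist.
  replace (minus y x) with (opp (minus x y)) by module_eq.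
  symmetry; exact (norm_opp (minus x y)).
Qed.

Lemma ndist_triangle (z x y : X) : ndist x y <= ndist x z + ndist z y.
Proof.
  unfold ndist.
  replace (minus x y) with (plus (minus x z) (minus z y)) by module_eq.
  apply norm_plus_le.
Qed.

Lemma ndist_le_norm (x y : X) : ndist x y <= norm x + norm y.
Proof.
  replace (norm y) with (norm (opp y)) by exact (norm_opp y).
  exact (norm_triangle x (opp y)).
Qed.

Lemma norm_le_ndist (x y : X) : norm x <= ndist x y + norm y.
Proof.
  unfold ndist.
  replace x with (plus (minus x y) y) at 1 by module_eq. apply norm_plus_le.
Qed.

Lemma ndist_refl (x : X) : ndist x x = 0.
Proof.
  unfold ndist. replace (minus x x) with (zero : X) by module_eq.
  exact (norm_zero (V := X)).
Qed.

Lemma ndist_nonneg (x y : X) : 0 <= ndist x y.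
Proof. apply norm_nonneg. Qed.

Lemma ndist_eq (x y : X) : ndist x y <= 0 -> x = y.
Proof.
  intros H. assert (E : minus x y = zero).
  { apply (norm_eq_zero (V := X)).
    apply Rle_antisym; [exact H|apply norm_nonneg]. }
  replace x with (plus (minus x y) y) by module_eq. rewrite E. exact (plus_zero_l y).
Qed.

End Norms.

(** Applied to the supremum [S] of [F], the improvement yields [S <= q * S + c]. Finiteness of [S]
    must be known beforehand, hence the qualitative bound among the hypotheses. This plays the part
    of a maximum principle for the approximate equations. *)
Lemma le_of_affine_improvement {I : Type} (F : I -> R) (q c : R) :
  q < 1 -> (exists M, forall i, F i <= M) ->
  (forall M, (forall i, F i <= M) -> forall i, F i <= q * M + c) ->
  forall i, F i <= c / (1 - q).
Proof.
  intros Hq [M0 HM0] Himp i.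
  destruct (completeness (fun r => exists j, r = F j)) as [S [HS1 HS2]].
  - exists M0. intros r [j ->]. apply HM0.
  - exists (F i), i; reflexivity.
  - assert (HS : S <= q * S + c).
    { apply HS2. intros r [j ->]. apply Himp. intros j'. apply HS1. exists j'; reflexivity. }
    apply Rle_trans with S; [apply HS1; exists i; reflexivity|].
    apply Rmult_le_reg_r with (1 - q); [lra|].
    unfold Rdiv. rewrite Rmult_assoc, Rinv_l by lra. lra.
Qed.

(** * Exponential averages *)

Lemma is_RInt_exp_poly (lam c0 c1 c2 a b : R) : 0 < lam ->
  is_RInt (fun s => exp (- s / lam) * (c0 + c1 * s + c2 * s ^ 2)) a b
    ((fun s => - lam * exp (- s / lam) *
        (c0 + c1 * (s + lam) + c2 * (s ^ 2 + 2 * lam * s + 2 * lam ^ 2))) b -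
     (fun s => - lam * exp (- s / lam) *
        (c0 + c1 * (s + lam) + c2 * (s ^ 2 + 2 * lam * s + 2 * lam ^ 2))) a).
Proof.
  intros Hl.
  apply (is_RInt_derive (V := R_CompleteNormedModule)).
  - intros x _. auto_derive; [exact I|]. unfold Rdiv. field. lra.
  - intros x _. apply (ex_derive_continuous (V := R_NormedModule)). auto_derive. exact I.
Qed.

(** Cubic decay beats the quadratic polynomials integrated below and leaves a tail of order [1 / b].
    It is the cube of [x / 3 <= exp (x / 3)]. *)
Lemma exp_neg_le_inv_cube (x : R) : 0 < x -> exp (- x) <= 27 / x ^ 3.
Proof.
  intros Hx.
  assert (H3 : x / 3 <= exp (x / 3)) by (generalize (exp_ineq1_le (x / 3)); lra).
  rewrite exp_Ropp.
  replace (27 / x ^ 3) with (/ ((x / 3) ^ 3)) by (field; lra).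
  apply Rinv_le_contravar; [apply pow_lt; lra|].
  replace (exp x) with (exp (x / 3) ^ 3).
  - apply pow_incr; lra.
  - rewrite <- Rpower_pow by apply exp_pos. unfold Rpower. rewrite ln_exp. f_equal. simpl. lra.
Qed.

Lemma is_RInt_gen_exp_poly (lam c0 c1 c2 : R) : 0 < lam ->
  is_RInt_gen (fun s => exp (- s / lam) * (c0 + c1 * s + c2 * s ^ 2))
    (at_point 0) (Rbar_locally p_infty) (lam * (c0 + c1 * lam + 2 * c2 * lam ^ 2)).
Proof.
  intros Hl P [eps HP].
  (* [C * b ^ 2] dominates the polynomial in the antiderivative once [1 <= b]. With the cubic decay
     of the exponential, the error at the upper end [b] is then at most [K / b]. *)
  set (C := Rabs c0 + Rabs c1 * (1 + lam) + Rabs c2 * (1 + 2 * lam + 2 * lam ^ 2)).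
  assert (HC : 0 <= C).
  { unfold C. generalize (Rabs_pos c0) (Rabs_pos c1) (Rabs_pos c2). intros. nra. }
  set (K := lam * (27 * lam ^ 3) * C).
  assert (HK : 0 <= K).
  { unfold K. apply Rmult_le_pos; [|exact HC]. generalize (pow_lt lam 3 Hl). nra. }
  exists (fun a => a = 0) (fun b => Rmax 1 (K / eps) < b).
  - reflexivity.
  - exists (Rmax 1 (K / eps)); intros b Hb; exact Hb.
  - intros a b -> Hb. simpl.
    eexists; split; [apply is_RInt_exp_poly; exact Hl|].
    apply HP. cbv beta.
    assert (Hb1 : 1 < b) by (eapply Rle_lt_trans; [apply Rmax_l|exact Hb]).
    assert (Hb2 : K / eps < b) by (eapply Rle_lt_trans; [apply Rmax_r|exact Hb]).
    replace (- 0 / lam) with 0 by (field; lra). rewrite exp_0.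
    change (Rabs ((- lam * exp (- b / lam) *
       (c0 + c1 * (b + lam) + c2 * (b ^ 2 + 2 * lam * b + 2 * lam ^ 2)) -
      - lam * 1 * (c0 + c1 * (0 + lam) + c2 * (0 ^ 2 + 2 * lam * 0 + 2 * lam ^ 2))) -
      lam * (c0 + c1 * lam + 2 * c2 * lam ^ 2)) < eps).
    match goal with |- Rabs ?z < _ => replace z with
      (- (lam * exp (- b / lam) *
       (c0 + c1 * (b + lam) + c2 * (b ^ 2 + 2 * lam * b + 2 * lam ^ 2)))) by ring end.
    rewrite Rabs_Ropp, Rabs_mult.
    rewrite (Rabs_pos_eq (lam * _)) by (generalize (exp_pos (- b / lam)); nra).
    assert (Hpoly : Rabs (c0 + c1 * (b + lam) + c2 * (b ^ 2 + 2 * lam * b + 2 * lam ^ 2))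
              <= C * b ^ 2).
    { eapply Rle_trans; [apply Rabs_triang|].
      eapply Rle_trans; [apply Rplus_le_compat_r, Rabs_triang|].
      rewrite !Rabs_mult.
      rewrite (Rabs_pos_eq (b + lam)) by lra.
      rewrite (Rabs_pos_eq (b ^ 2 + _ + _)) by nra.
      unfold C.
      rewrite (Rmult_plus_distr_r (Rabs c0 + _)), (Rmult_plus_distr_r (Rabs c0)).
      assert (b <= b ^ 2) by nra.
      repeat apply Rplus_le_compat.
      - generalize (Rabs_pos c0); nra.
      - rewrite (Rmult_assoc (Rabs c1)). apply Rmult_le_compat_l; [apply Rabs_pos|nra].
      - rewrite (Rmult_assoc (Rabs c2)). apply Rmult_le_compat_l; [apply Rabs_pos|].
        assert (0 <= lam * (b ^ 2 - b)) by (apply Rmult_le_pos; lra).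
        assert (0 <= lam ^ 2 * (b ^ 2 - 1)) by (apply Rmult_le_pos; nra). nra. }
    assert (Hexp : exp (- b / lam) <= 27 * lam ^ 3 / b ^ 3).
    { replace (- b / lam) with (- (b / lam)) by (field; lra).
      replace (27 * lam ^ 3 / b ^ 3) with (27 / (b / lam) ^ 3) by (field; lra).
      apply exp_neg_le_inv_cube. apply Rdiv_lt_0_compat; lra. }
    apply Rle_lt_trans with (lam * (27 * lam ^ 3 / b ^ 3) * (C * b ^ 2)).
    + apply Rmult_le_compat; [generalize (exp_pos (- b / lam)); nra|apply Rabs_pos| |exact Hpoly].
      apply Rmult_le_compat_l; lra.
    + replace (lam * (27 * lam ^ 3 / b ^ 3) * (C * b ^ 2)) with (K / b)
        by (unfold K; field; lra).
      apply Rmult_lt_reg_r with b; [lra|].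
      unfold Rdiv. rewrite Rmult_assoc, Rinv_l, Rmult_1_r by lra.
      apply Rmult_lt_reg_r with (/ eps); [apply Rinv_0_lt_compat, cond_pos|].
      replace (eps * b * / eps) with b by (field; apply Rgt_not_eq, cond_pos).
      exact Hb2.
Qed.

(** The mean of [f] at an exponentially distributed time of mean [lam], in the shape to which
    [yosida_deriv] unfolds by conversion. *)
Definition exp_avg {X : CompleteNormedModule R_AbsRing} (lam : R) (f : R -> X) : X :=
  scal (/ lam)
    (RInt_gen (fun s => scal (exp (- s / lam)) (f s))
       (at_point 0) (Rbar_locally p_infty)).

Section ExpAverage.
Context {X : CompleteNormedModule R_AbsRing}.

Lemma ex_RInt_exp (lam a b : R) (f : R -> X) :
  (forall s, continuous f s) ->
  ex_RInt (fun s => scal (exp (- s / lam)) (f s)) a b.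
Proof.
  intros Hf. apply ex_RInt_continuous. intros s _.
  apply (continuous_scal (fun s => exp (- s / lam)) f); [|apply Hf].
  apply (ex_derive_continuous (V := R_NormedModule)). auto_derive. exact I.
Qed.

Lemma ex_RInt_gen_exp (lam : R) (f : R -> X) : 0 < lam ->
  bounded_fun f -> (forall s, continuous f s) ->
  ex_RInt_gen (fun s => scal (exp (- s / lam)) (f s)) (at_point 0) (Rbar_locally p_infty).
Proof.
  intros Hl [M HM] Hf.
  set (F := fun s => scal (exp (- s / lam)) (f s)).
  assert (HFi : forall a b, ex_RInt F a b) by (intros; apply ex_RInt_exp, Hf).
  assert (HM0 : 0 <= M) by (generalize (HM 0) (norm_ge_0 (f 0)); lra).
  (* The crude rate [1 / a], from [exp (- x) <= 1 / x], already makes the truncated integrals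
     Cauchy; completeness of [X] supplies the limit. *)
  assert (Htail : forall a b, 0 < a -> a <= b -> norm (RInt F a b) <= M * lam ^ 2 / a).
  { intros a b Ha Hab.
    generalize (is_RInt_exp_poly lam M 0 0 a b Hl). intros Hg.
    eapply Rle_trans.
    - eapply (norm_RInt_le F _ a b); [exact Hab| |apply RInt_correct, HFi|exact Hg].
      intros s _. unfold F. eapply Rle_trans; [apply norm_scal_pos|].
      + left; apply exp_pos.
      + replace (M + 0 * s + 0 * s ^ 2) with M by ring.
        apply Rmult_le_compat_l; [left; apply exp_pos|apply HM].
    - cbv beta.
      assert (He : exp (- a / lam) <= lam / a).
      { replace (- a / lam) with (- (a / lam)) by (field; lra). rewrite exp_Ropp.
        replace (lam / a) with (/ (a / lam)) by (field; lra).
        assert (0 < a / lam) by (apply Rdiv_lt_0_compat; lra).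
        apply Rinv_le_contravar; [assumption|].
        generalize (exp_ineq1_le (a / lam)); lra. }
      assert (0 <= lam * exp (- b / lam) * M).
      { apply Rmult_le_pos; [|exact HM0]. generalize (exp_pos (- b / lam)); nra. }
      replace (M * lam ^ 2 / a) with (lam * M * (lam / a)) by (field; lra).
      apply Rle_trans with (lam * M * exp (- a / lam)); [nra|].
      apply Rmult_le_compat_l; [nra|exact He]. }
  destruct (proj1 (filterlim_locally_cauchy (F := Rbar_locally p_infty) (fun b => RInt F 0 b)))
    as [l Hlim].
  { intros eps.
    set (K := M * lam ^ 2 / eps).
    exists (fun b => Rmax 0 K < b). split; [exists (Rmax 0 K); intros b Hb; exact Hb|].
    assert (Hord : forall a b, Rmax 0 K < a -> a <= b ->
              ndist (RInt F 0 b) (RInt F 0 a) < eps).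
    { intros a b Ha Hab. unfold ndist.
      assert (Ha0 : 0 < a) by (eapply Rle_lt_trans; [apply Rmax_l|exact Ha]).
      assert (HaK : K < a) by (eapply Rle_lt_trans; [apply Rmax_r|exact Ha]).
      rewrite <- (RInt_Chasles F 0 a b) by apply HFi.
      replace (minus (plus (RInt F 0 a) (RInt F a b)) (RInt F 0 a)) with (RInt F a b)
        by module_eq.
      eapply Rle_lt_trans; [apply Htail; assumption|].
      apply Rmult_lt_reg_r with a; [exact Ha0|].
      apply Rmult_lt_reg_r with (/ eps); [apply Rinv_0_lt_compat, cond_pos|].
      replace (M * lam ^ 2 / a * a * / eps) with K
        by (unfold K; field; split; [apply Rgt_not_eq, cond_pos|lra]).
      replace (eps * a * / eps) with a by (field; apply Rgt_not_eq, cond_pos).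
      exact HaK. }
    intros a b Ha Hb. apply (norm_compat1 (V := X)).
    destruct (Rle_dec a b) as [Hab|Hab].
    - apply Hord; assumption.
    - apply Rle_lt_trans with (ndist (RInt F 0 a) (RInt F 0 b)).
      + right; apply ndist_sym.
      + apply Hord; [assumption|lra]. }
  exists l. intros P HP.
  exists (fun a => a = 0) (fun b => P (RInt F 0 b)); [reflexivity|apply Hlim, HP|].
  intros a b -> Hb. exists (RInt F 0 b); split; [apply RInt_correct, HFi|exact Hb].
Qed.

(** The right-hand side consists of the moments [1], [lam] and [2 * lam ^ 2] of the exponential law.
    The coefficients may have any sign; the doubled estimate uses a [c1] of either sign. *)
Lemma exp_avg_minus_le (lam c0 c1 c2 : R) (f1 f2 : R -> X) : 0 < lam ->
  bounded_fun f1 -> (forall s, continuous f1 s) ->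
  bounded_fun f2 -> (forall s, continuous f2 s) ->
  (forall s, 0 <= s -> ndist (f1 s) (f2 s) <= c0 + c1 * s + c2 * s ^ 2) ->
  ndist (exp_avg lam f1) (exp_avg lam f2) <= c0 + c1 * lam + 2 * c2 * lam ^ 2.
Proof.
  intros Hl Hb1 Hc1 Hb2 Hc2 Hle. unfold exp_avg.
  generalize (RInt_gen_correct _ (ex_RInt_gen_exp lam f1 Hl Hb1 Hc1)).
  generalize (RInt_gen_correct _ (ex_RInt_gen_exp lam f2 Hl Hb2 Hc2)).
  set (l1 := RInt_gen _ _ _). set (l2 := RInt_gen _ _ _). intros H1 H2.
  generalize (is_RInt_gen_minus _ _ _ _ H2 H1). intros H.
  assert (Hn : ndist l2 l1 <= lam * (c0 + c1 * lam + 2 * c2 * lam ^ 2)).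
  { refine (RInt_gen_norm _ _ _ _ _ _ H (is_RInt_gen_exp_poly lam c0 c1 c2 Hl)).
    - exists (fun a => a = 0) (fun b => 0 < b); [reflexivity|exists 0; auto|].
      intros a b -> Hb; simpl; lra.
    - exists (fun a => a = 0) (fun b => 0 < b); [reflexivity|exists 0; auto|].
      intros a b -> Hb s Hs; simpl in Hs.
      apply (norm_eq_le _ (scal (exp (- s / lam)) (minus (f1 s) (f2 s)))); [module_eq|].
      eapply Rle_trans; [apply norm_scal_pos; left; apply exp_pos|].
      apply Rmult_le_compat_l; [left; apply exp_pos|]. apply Hle; lra. }
  apply (norm_eq_le _ (scal (/ lam) (minus l2 l1))); [module_eq|].
  unfold ndist in Hn.
  assert (Hil : 0 < / lam) by (apply Rinv_0_lt_compat; exact Hl).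
  eapply Rle_trans; [apply norm_scal_pos; lra|].
  apply Rmult_le_reg_l with lam; [exact Hl|].
  rewrite <- Rmult_assoc, Rinv_r by lra. lra.
Qed.

Lemma exp_avg_const (lam : R) (x : X) : 0 < lam -> exp_avg lam (fun _ => x) = x.
Proof.
  intros Hl. unfold exp_avg.
  rewrite (is_RInt_gen_unique _ (scal lam x)).
  { replace (scal (/ lam) (scal lam x)) with x; [reflexivity|].
    module_eq. }
  intros P HP.
  (* Each truncated integral is a scalar integral times [x], so the scalar limit is carried over by
     continuity of [l] to [scal l x]. *)
  assert (Hc : filterlim (fun l : R => scal l x) (locally lam) (locally (scal lam x)))
    by apply (filterlim_scal_l (K := R_AbsRing) lam x).
  generalize (is_RInt_gen_exp_poly lam 1 0 0 Hl).
  replace (lam * (1 + 0 * lam + 2 * 0 * lam ^ 2)) with lam by ring.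
  intros Hg. destruct (Hg _ (Hc P HP)) as [Qa Qb HQ HR H].
  exists Qa Qb; [exact HQ|exact HR|]. intros a b Ha Hb.
  destruct (H a b Ha Hb) as [y [Hy HPy]]. exists (scal y x); split; [|exact HPy].
  cbv [fst snd] in *.
  set (h := fun s => - lam * exp (- s / lam)).
  replace (scal y x) with (minus (scal (h b) x) (scal (h a) x)).
  - apply (is_RInt_derive (V := X) (fun s => scal (h s) x)).
    + intros s _. apply (is_derive_scal_l (V := X) h). unfold h. auto_derive; [exact I|]. unfold Rdiv; field; lra.
    + intros s _. apply (continuous_scal (V := X) (fun s => exp (- s / lam)) (fun _ => x)).
      * apply (ex_derive_continuous (V := R_NormedModule)). auto_derive. exact I.
      * apply continuous_const.
  - rewrite <- (is_RInt_unique _ _ _ _ Hy).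
    rewrite (is_RInt_unique _ _ _ _ (is_RInt_exp_poly lam 1 0 0 a b Hl)).
    unfold h. module_eq.
Qed.

End ExpAverage.

(** * Suprema *)

(** An element and an upper bound together make the least upper bound finite. If either is missing,
    [Lub_Rbar] is infinite and [real] returns its default value 0. *)
Lemma real_Lub_Rbar_bounds (E : R -> Prop) (x0 D : R) :
  E x0 -> (forall x, E x -> x <= D) -> x0 <= real (Lub_Rbar E) <= D.
Proof.
  intros Hx0 HD. destruct (Lub_Rbar_correct E) as [Hub Hleast].
  assert (H1 : Rbar_le (Lub_Rbar E) D) by (apply Hleast; intros x Hx; exact (HD x Hx)).
  assert (H0 : Rbar_le x0 (Lub_Rbar E)) by (apply Hub, Hx0).
  destruct (Lub_Rbar E) as [r| |]; simpl in *; try contradiction; split; assumption.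
Qed.

Lemma delay_interval_0 (d : delay) : delay_interval d 0.
Proof. destruct d as [|r]; simpl; [lra|generalize (cond_pos r); lra]. Qed.

(** Witness that the set of norms behind [sup_norm] is nonempty, which keeps its supremum away from
    [m_infty]. *)
Definition delay_zero (d : delay) : delay_dom d := exist _ 0 (delay_interval_0 d).

Section History.
Context {X : CompleteNormedModule R_AbsRing} {d : delay}.

Lemma hdist_le (phi1 phi2 : history X d) (D : R) :
  (forall s, ndist (phi1 s) (phi2 s) <= D) -> hdist phi1 phi2 <= D.
Proof.
  intros H. apply (real_Lub_Rbar_bounds _
    (ndist (phi1 (delay_zero d)) (phi2 (delay_zero d)))).
  - exists (delay_zero d); reflexivity.
  - intros x [s ->]; apply H.
Qed.

Lemma hnorm_bounds (phi : history X d) (D : R) :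
  (forall s, norm (phi s) <= D) -> 0 <= hnorm phi <= D.
Proof.
  intros H.
  destruct (real_Lub_Rbar_bounds (fun r => exists s, r = norm (phi s))
    (norm (phi (delay_zero d))) D) as [H1 H2].
  - exists (delay_zero d); reflexivity.
  - intros x [s ->]; apply H.
  - split; [|exact H2]. exact (Rle_trans _ _ _ (norm_nonneg _) H1).
Qed.

End History.

Lemma lip_const_spec {X : CompleteNormedModule R_AbsRing} (g : R -> X) :
  lipschitz g -> 0 <= lip_const g /\
  forall s t, ndist (g s) (g t) <= lip_const g * Rabs (s - t).
Proof.
  intros [L HL].
  assert (Hub : forall q, (exists s t, s <> t /\
            q = ndist (g s) (g t) / Rabs (s - t)) -> q <= L).
  { intros q (s & t & Hst & ->).
    assert (0 < Rabs (s - t)) by (apply Rabs_pos_lt; lra).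
    apply Rmult_le_reg_r with (Rabs (s - t)); [assumption|].
    unfold Rdiv. rewrite Rmult_assoc, Rinv_l by lra. rewrite Rmult_1_r. apply HL. }
  split.
  - apply Rle_trans with (ndist (g 1) (g 0) / Rabs (1 - 0)).
    + apply Rmult_le_pos; [apply norm_nonneg|]. rewrite Rabs_pos_eq by lra. lra.
    + apply (real_Lub_Rbar_bounds _ _ L); [|exact Hub].
      exists 1, 0; split; [lra|reflexivity].
  - intros s t. destruct (Req_dec s t) as [->|Hst].
    + rewrite ndist_refl. unfold Rminus. rewrite Rplus_opp_r, Rabs_R0. lra.
    + assert (0 < Rabs (s - t)) by (apply Rabs_pos_lt; lra).
      apply Rmult_le_reg_r with (/ Rabs (s - t)); [apply Rinv_0_lt_compat; assumption|].
      rewrite (Rmult_assoc (lip_const g)), Rinv_r, Rmult_1_r by lra.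
      apply (real_Lub_Rbar_bounds _ _ L); [|exact Hub].
      exists s, t; split; [assumption|reflexivity].
Qed.

(** * Bounded uniformly continuous functions *)

Notation is_BUC_R := (is_BUC (fun t : R => t)).

Section BUCFunctions.
Context {X : CompleteNormedModule R_AbsRing}.

Lemma is_BUC_bound (f : R -> X) : is_BUC_R f ->
  exists M, 0 <= M /\ forall t, norm (f t) <= M.
Proof.
  intros [[M HM] _]. exists M; split; [|exact HM].
  exact (Rle_trans _ _ _ (norm_nonneg _) (HM 0)).
Qed.

Lemma is_BUC_modulus (f : R -> X) (eps : R) : is_BUC_R f -> 0 < eps ->
  exists delta, 0 < delta /\
    forall s t, Rabs (t - s) < delta -> ndist (f t) (f s) < eps.
Proof. intros [_ Hf] Heps. exact (Hf eps Heps). Qed.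

Lemma BUC_bound (u : BUC X) : exists M, 0 <= M /\ forall t, norm (u t) <= M.
Proof. apply is_BUC_bound, BUC_prop. Qed.

Lemma BUC_dist_bound (u v : BUC X) :
  exists D, 0 <= D /\ forall t, ndist (u t) (v t) <= D.
Proof.
  destruct (BUC_bound u) as (M & HM0 & HM). destruct (BUC_bound v) as (N & HN0 & HN).
  exists (M + N); split; [lra|]. intros t. eapply Rle_trans; [apply ndist_le_norm|].
  generalize (HM t) (HN t); lra.
Qed.

Lemma BUC_continuous (u : BUC X) (t : R) : continuous u t.
Proof.
  apply filterlim_locally. intros eps.
  destruct (BUC_prop _ u) as [_ Hu]. destruct (Hu eps (cond_pos eps)) as (delta & Hd & H).
  exists (mkposreal delta Hd). intros s Hs. apply (norm_compat1 (V := X)). apply H, Hs.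
Qed.

Lemma BUC_reflect_bounded (u : BUC X) (t : R) : bounded_fun (fun s => u (t - s)).
Proof.
  destruct (BUC_prop _ u) as [[M HM] _]. exists M; intros s; apply HM.
Qed.

Lemma BUC_reflect_continuous (u : BUC X) (t s : R) : continuous (fun s => u (t - s)) s.
Proof.
  apply (continuous_comp (fun s => t - s) u); [|apply BUC_continuous].
  apply (ex_derive_continuous (V := R_NormedModule)). auto_derive. exact I.
Qed.

Lemma lipschitz_is_BUC (f : R -> X) : bounded_fun f -> lipschitz f -> is_BUC_R f.
Proof.
  intros Hb [L HL]. split; [exact Hb|]. intros eps Heps.
  assert (HL0 : 0 < Rabs L + 1) by (generalize (Rabs_pos L); lra).
  exists (eps / (Rabs L + 1)); split; [apply Rdiv_lt_0_compat; assumption|].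
  intros s t Hst. eapply Rle_lt_trans; [apply HL|].
  apply Rle_lt_trans with ((Rabs L + 1) * Rabs (t - s)).
  - apply Rmult_le_compat_r; [apply Rabs_pos|]. generalize (Rle_abs L); lra.
  - apply Rlt_le_trans with ((Rabs L + 1) * (eps / (Rabs L + 1))).
    + apply Rmult_lt_compat_l; assumption.
    + right; field; lra.
Qed.

Lemma is_BUC_const (x : X) : is_BUC_R (fun _ => x).
Proof.
  split; [exists (norm x); intros; lra|]. intros eps Heps. exists 1; split; [lra|].
  intros s t _. exact (Rle_lt_trans _ _ _ (Req_le _ _ (ndist_refl x)) Heps).
Qed.

(* The quadratic majorant makes the modulus of continuity compatible with the
   supersolution [b (s - t)^2] of the doubled equation. *)
Lemma BUC_quadratic_modulus (f : R -> X) (eps : R) : is_BUC_R f -> 0 < eps ->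
  exists C, 0 <= C /\
    forall s t, ndist (f s) (f t) <= eps + C * (s - t) ^ 2.
Proof.
  intros Hf Heps. destruct (is_BUC_bound f Hf) as (M & HM0 & HM).
  destruct (is_BUC_modulus f eps Hf Heps) as (delta & Hd & H).
  exists (2 * M / delta ^ 2).
  assert (Hd2 : 0 < delta ^ 2) by (apply pow_lt; exact Hd).
  assert (HC : 0 <= 2 * M / delta ^ 2).
  { apply Rmult_le_pos; [lra|]. left; apply Rinv_0_lt_compat; exact Hd2. }
  split; [exact HC|].
  intros s t. assert (Hsq : 0 <= (s - t) ^ 2) by apply pow2_ge_0.
  destruct (Rlt_dec (Rabs (s - t)) delta) as [Hst|Hst].
  - generalize (H t s Hst). nra.
  - apply Rnot_lt_le in Hst.
    assert (Hge : delta ^ 2 <= (s - t) ^ 2).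
    { rewrite <- (pow2_abs (s - t)). apply pow_incr; lra. }
    apply Rle_trans with (2 * M / delta ^ 2 * delta ^ 2); [|nra].
    replace (2 * M / delta ^ 2 * delta ^ 2) with (2 * M) by (field; lra).
    eapply Rle_trans; [apply ndist_le_norm|]. generalize (HM s) (HM t); lra.
Qed.

(** The resolvent of the time derivative, that is the inverse of [1 + lam d/dt] on bounded functions
    on the line. *)
Definition delayed_avg (lam : R) (u : R -> X) (t : R) : X :=
  exp_avg lam (fun s => u (t - s)).

Lemma delayed_avg_minus_le (lam c0 c1 c2 s t : R) (u v : BUC X) : 0 < lam ->
  (forall r, 0 <= r -> ndist (u (s - r)) (v (t - r)) <= c0 + c1 * r + c2 * r ^ 2) ->
  ndist (delayed_avg lam u s) (delayed_avg lam v t) <=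
    c0 + c1 * lam + 2 * c2 * lam ^ 2.
Proof.
  intros Hl H. apply exp_avg_minus_le; try assumption;
    (apply BUC_reflect_bounded || (intros r; apply BUC_reflect_continuous)).
Qed.

Lemma delayed_avg_minus_const_le (lam c0 c1 c2 t : R) (u : BUC X) (x : X) : 0 < lam ->
  (forall r, 0 <= r -> ndist (u (t - r)) x <= c0 + c1 * r + c2 * r ^ 2) ->
  ndist (delayed_avg lam u t) x <= c0 + c1 * lam + 2 * c2 * lam ^ 2.
Proof.
  intros Hl H.
  apply (norm_eq_le _ (minus (delayed_avg lam u t) (exp_avg lam (fun _ => x)))).
  { rewrite exp_avg_const by exact Hl. reflexivity. }
  apply exp_avg_minus_le; try assumption;
    first [apply BUC_reflect_bounded | intros r; apply BUC_reflect_continuous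
          | exists (norm x); intros; lra | intros r; apply continuous_const].
Qed.

Lemma delayed_avg_is_BUC (lam : R) (u : BUC X) : 0 < lam ->
  is_BUC_R (delayed_avg lam u).
Proof.
  intros Hl. split.
  - destruct (BUC_bound u) as (M & _ & HM). exists M. intros t.
    replace (delayed_avg lam u t) with (minus (delayed_avg lam u t) zero) by module_eq.
    replace M with (M + 0 * lam + 2 * 0 * lam ^ 2) by ring.
    apply delayed_avg_minus_const_le; [exact Hl|]. intros r _.
    apply (norm_eq_le _ (u (t - r))); [module_eq|]. generalize (HM (t - r)); lra.
  - intros eps Heps. 
    destruct (is_BUC_modulus u (eps / 2) (BUC_prop _ u)) as (delta & Hd & H); [lra|].
    exists delta; split; [exact Hd|]. intros s s' Hs.
    change (ndist (delayed_avg lam u s') (delayed_avg lam u s) < eps).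
    apply Rle_lt_trans with (eps / 2 + 0 * lam + 2 * 0 * lam ^ 2); [|lra].
    apply delayed_avg_minus_le; [exact Hl|]. intros r _.
    assert (Hr : ndist (u (s' - r)) (u (s - r)) < eps / 2).
    { apply H. replace (s' - r - (s - r)) with (s' - s) by ring. exact Hs. }
    lra.
Qed.

(** * Uniform limits *)

Lemma unif_cauchy_lim {I : Type} (F : (I -> Prop) -> Prop) {FF : ProperFilter F}
    (f : I -> R -> X) :
  (forall eps, 0 < eps -> exists P, F P /\
    forall i j, P i -> P j -> forall t, ndist (f i t) (f j t) <= eps) ->
  exists l, unif_lim F f l.
Proof.
  intros Hc.
  assert (Hpt : forall t, exists y : X, filterlim (fun i => f i t) F (locally y)).
  { intros t. apply (proj1 (filterlim_locally_cauchy (U := X) (fun i => f i t))).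
    intros eps. destruct (Hc (eps / 2)) as (P & HP & H).
    - generalize (cond_pos eps); lra.
    - exists P; split; [exact HP|]. intros i j Hi Hj. apply (norm_compat1 (V := X)).
      eapply Rle_lt_trans; [apply (H j i Hj Hi t)|]. generalize (cond_pos eps); lra. }
  exists (fun t => proj1_sig (constructive_indefinite_description _ (Hpt t))).
  intros eps Heps. destruct (Hc (eps / 2)) as (P & HP & H); [lra|].
  apply filter_imp with (2 := HP). intros i Hi t.
  destruct (constructive_indefinite_description _ (Hpt t)) as [l Hl]; simpl.
  assert (Hball : F (fun j => ball_norm l (eps / 4) (f j t))).
  { apply Hl. apply (locally_le_locally_norm (V := X)).
    assert (He4 : 0 < eps / 4) by lra.
    exists (mkposreal _ He4). intros y Hy; exact Hy. }
  (* The index [j] depends on [t], but the bound obtained through it does not, so the convergence is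
     uniform. *)
  destruct (filter_ex _ (filter_and _ _ HP Hball)) as (j & Hj & Hlj).
  eapply Rle_lt_trans; [apply (ndist_triangle (f j t))|].
  assert (Hlj' : ndist (f j t) l < eps / 4) by exact Hlj.
  generalize (H i j Hi Hj t); lra.
Qed.

Lemma unif_lim_ndist {I : Type} (F : (I -> Prop) -> Prop) (f : I -> R -> X)
    (l : R -> X) (eps : R) :
  unif_lim F f l -> 0 < eps -> F (fun i => forall t, ndist (f i t) (l t) < eps).
Proof. intros H Heps; exact (H eps Heps). Qed.

Lemma unif_lim_is_BUC {I : Type} (F : (I -> Prop) -> Prop) {FF : ProperFilter F}
    (f : I -> BUC X) (l : R -> X) :
  unif_lim F (fun i => BUC_fun X (f i)) l -> is_BUC_R l.
Proof.
  intros Hlim. split.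
  - destruct (filter_ex _ (unif_lim_ndist _ _ _ _ Hlim Rlt_0_1)) as [i Hi].
    destruct (BUC_bound (f i)) as (M & _ & HM). exists (1 + M). intros t.
    eapply Rle_trans; [apply (norm_le_ndist _ (f i t))|].
    rewrite ndist_sym. generalize (Hi t) (HM t); lra.
  - intros eps Heps. assert (He3 : 0 < eps / 3) by lra.
    destruct (filter_ex _ (unif_lim_ndist _ _ _ _ Hlim He3)) as [i Hi].
    destruct (is_BUC_modulus (f i) (eps / 3) (BUC_prop _ (f i))) as (delta & Hd & H); [lra|].
    exists delta; split; [exact Hd|]. intros s s' Hs.
    change (ndist (l s') (l s) < eps).
    eapply Rle_lt_trans; [apply (ndist_triangle (f i s'))|].
    eapply Rle_lt_trans; [apply Rplus_le_compat_l, (ndist_triangle (f i s))|].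
    rewrite (ndist_sym (l s')).
    generalize (Hi s) (Hi s') (H s s' Hs); lra.
Qed.

Lemma unif_lim_dist_le {I : Type} (F : (I -> Prop) -> Prop) {FF : ProperFilter F}
    (f g : I -> R -> X) (l m : R -> X) (c : R) :
  unif_lim F f l -> unif_lim F g m ->
  F (fun i => forall t, ndist (f i t) (g i t) <= c) ->
  forall t, ndist (l t) (m t) <= c.
Proof.
  intros Hf Hg Hc t. apply le_epsilon. intros eps Heps.
  assert (He2 : 0 < eps / 2) by lra.
  generalize (unif_lim_ndist _ _ _ _ Hf He2) (unif_lim_ndist _ _ _ _ Hg He2). intros Hf' Hg'.
  destruct (filter_ex _ (filter_and _ _ (filter_and _ _ Hf' Hg') Hc)) as (i & (H1 & H2) & H3).
  eapply Rle_trans; [apply (ndist_triangle (f i t))|].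
  eapply Rle_trans; [apply Rplus_le_compat_l, (ndist_triangle (g i t))|].
  rewrite (ndist_sym (l t)). generalize (H1 t) (H2 t) (H3 t); lra.
Qed.

(** * Contractions of bounded uniformly continuous functions *)

Lemma pow_eventually_small (q B eps : R) : 0 <= q < 1 -> 0 <= B -> 0 < eps ->
  exists N, forall n, (N <= n)%nat -> q ^ n * B < eps.
Proof.
  intros Hq HB Heps. destruct (pow_lt_1_zero q) with (y := eps / (B + 1)) as [N HN].
  - rewrite Rabs_pos_eq; lra.
  - apply Rdiv_lt_0_compat; lra.
  - exists N. intros n Hn. specialize (HN n Hn).
    assert (Hp : 0 <= q ^ n) by (apply pow_le; lra).
    rewrite Rabs_pos_eq in HN by exact Hp.
    apply Rle_lt_trans with (q ^ n * (B + 1)); [nra|].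
    apply Rlt_le_trans with (eps / (B + 1) * (B + 1)); [|right; field; lra].
    apply Rmult_lt_compat_r; lra.
Qed.

(** Banach's theorem with distances kept as pointwise bounds, because [BUC X] is a bare record. With
    [D = 0] the hypothesis makes [T] respect pointwise equality, so equality of records never has to
    be proved. *)
Lemma BUC_contraction_fixed_point (T : BUC X -> BUC X) (q : R) : 0 <= q < 1 ->
  (forall D (u v : BUC X), (forall t, ndist (u t) (v t) <= D) ->
    forall t, ndist (T u t) (T v t) <= q * D) ->
  exists u : BUC X, (forall t, T u t = u t) /\
    forall psi, unif_lim eventually (fun n => BUC_fun X (Nat.iter n T psi)) u.
Proof.
  intros Hq HT.
  assert (Hiter : forall n D (u v : BUC X), (forall t, ndist (u t) (v t) <= D) ->
    forall t, ndist (Nat.iter n T u t) (Nat.iter n T v t) <= q ^ n * D).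
  { induction n as [|n IH]; intros D u v H t.
    - simpl. rewrite Rmult_1_l. apply H.
    - simpl. rewrite Rmult_assoc. apply HT. apply IH, H. }
  set (x0 := mkBUC X (fun _ => zero) (is_BUC_const zero)).
  set (x := fun n => Nat.iter n T x0).
  destruct (BUC_dist_bound (T x0) x0) as (D & HD0 & HD).
  (* The solution of [q * B + D = B]: the radius of a ball about [x0] that [T] maps into itself, so
     the whole orbit stays in it. *)
  set (B := D / (1 - q)).
  assert (HBq : q * B + D = B) by (unfold B; field; lra).
  assert (HB0 : 0 <= B).
  { unfold B. apply Rmult_le_pos; [exact HD0|]. left; apply Rinv_0_lt_compat; lra. }
  assert (HB : forall n t, ndist (x n t) (x0 t) <= B).
  { induction n as [|n IH]; intros t.
    - unfold x; simpl. exact (Rle_trans _ _ _ (Req_le _ _ (ndist_refl zero)) HB0).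
    - rewrite <- HBq. eapply Rle_trans; [apply (ndist_triangle (T x0 t))|].
      apply Rplus_le_compat; [|apply HD]. apply HT. exact IH. }
  assert (Hcauchy : forall k n t, ndist (x (k + n)%nat t) (x n t) <= q ^ n * B).
  { intros k n t. unfold x. rewrite Nat.add_comm, Nat.iter_add.
    apply Hiter. intros s. apply (HB k s). }
  destruct (unif_cauchy_lim eventually (fun n => BUC_fun X (x n))) as [l Hl].
  { intros eps Heps. destruct (pow_eventually_small q B eps Hq HB0 Heps) as [N HN].
    exists (fun n => (N <= n)%nat). split; [exists N; auto|].
    intros i j Hi Hj t. destruct (Nat.le_ge_cases i j) as [Hij|Hij].
    - rewrite ndist_sym. replace j with ((j - i) + i)%nat by lia.
      left. eapply Rle_lt_trans; [apply Hcauchy|apply HN, Hi].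
    - replace i with ((i - j) + j)%nat by lia.
      left. eapply Rle_lt_trans; [apply Hcauchy|apply HN, Hj]. }
  set (u := mkBUC X l (unif_lim_is_BUC eventually x l Hl)).
  assert (Hfix : forall t, T u t = u t).
  { intros t. apply ndist_eq, le_epsilon. intros eps Heps.
    destruct (unif_lim_ndist _ _ _ (eps / 2) Hl) as [N HN]; [lra|].
    eapply Rle_trans; [apply (ndist_triangle (x (S N) t))|].
    assert (H1 : ndist (T u t) (x (S N) t) <= q * (eps / 2)).
    { change (x (S N)) with (T (x N)). apply HT. intros s. rewrite ndist_sym.
      left. apply (HN N (Nat.le_refl N) s). }
    assert (H2 : ndist (x (S N) t) (u t) < eps / 2) by (apply HN; lia).
    nra. }
  exists u; split; [exact Hfix|]. intros psi eps Heps.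
  assert (Hfixn : forall n t, Nat.iter n T u t = u t).
  { induction n as [|n IH]; intros t; [reflexivity|].
    rewrite <- (Hfix t). simpl. apply ndist_eq.
    (* The iterate and [u] agree only pointwise, so [T] cannot be rewritten under; contraction from
       distance 0 replaces the rewriting. *)
    apply Rle_trans with (q * 0); [|lra]. apply HT. intros s.
    rewrite IH, ndist_refl. lra. }
  destruct (BUC_dist_bound psi u) as (D1 & HD10 & HD1).
  destruct (pow_eventually_small q D1 eps Hq HD10 Heps) as [N HN].
  exists N. intros n Hn t. rewrite <- (Hfixn n t).
  eapply Rle_lt_trans; [apply Hiter; exact HD1|apply HN, Hn].
Qed.


(** * Density of Lipschitz functions *)

Lemma moving_average_lipschitz (v : BUC X) (delta M s t : R) : 0 < delta -> s <= t ->
  (forall r, norm (v r) <= M) ->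
  ndist (scal (/ delta) (RInt v s (s + delta))) (scal (/ delta) (RInt v t (t + delta))) <=
  2 * M / delta * (t - s).
Proof.
  intros Hd Hst HM.
  assert (Hi : forall a b, ex_RInt v a b)
    by (intros; apply ex_RInt_continuous; intros; apply BUC_continuous).
  assert (Hid : 0 < / delta) by (apply Rinv_0_lt_compat, Hd).
  assert (Hshort : forall a, norm (RInt v a (a + (t - s))) <= (t - s) * M).
  { intros a. replace (t - s) with (a + (t - s) - a) at 2 by ring.
    apply (norm_RInt_le_const v); [lra|intros; apply HM|apply RInt_correct, Hi]. }
  generalize (Hshort s) (Hshort (s + delta)).
  replace (s + (t - s)) with t by ring.
  replace (s + delta + (t - s)) with (t + delta) by ring. intros H1 H2.
  (* The two windows differ by the integrals over [[s, t]] and [[s + delta, t + delta]]. With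
     oriented integrals this holds even when the windows are disjoint. *)
  apply (norm_eq_le _ (scal (/ delta) (minus (RInt v s t) (RInt v (s + delta) (t + delta))))).
  - generalize (RInt_Chasles v s t (t + delta) (Hi _ _) (Hi _ _))
      (RInt_Chasles v s (s + delta) (t + delta) (Hi _ _) (Hi _ _)).
    set (a := RInt v s t). set (b := RInt v t (t + delta)).
    set (c := RInt v s (s + delta)). set (e := RInt v (s + delta) (t + delta)).
    intros E1 E2. rewrite <- E1 in E2.
    transitivity (scal (/ delta) (minus (minus (plus c e) e) b)); [module_eq|].
    rewrite E2. module_eq.
  - eapply Rle_trans; [apply norm_scal_pos; lra|].
    unfold Rdiv. rewrite (Rmult_comm (2 * M)), Rmult_assoc.
    apply Rmult_le_compat_l; [lra|].
    eapply Rle_trans; [apply ndist_le_norm|]. lra.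
Qed.

Lemma lipschitz_dense_in_BUC (v : BUC X) (eps : R) : 0 < eps ->
  exists v' : BUC X, (exists L, 0 <= L /\ forall s t, ndist (v' s) (v' t) <= L * Rabs (s - t)) /\
    forall t, ndist (v t) (v' t) <= eps.
Proof.
  intros Heps.
  destruct (BUC_bound v) as (M & HM0 & HM).
  destruct (is_BUC_modulus v eps (BUC_prop _ v) Heps) as (delta0 & Hd0 & Hmod).
  (* Halving keeps the closed window strictly inside the range of the modulus of continuity. *)
  set (delta := delta0 / 2).
  assert (Hd : 0 < delta) by (unfold delta; lra).
  assert (Hid : 0 < / delta) by (apply Rinv_0_lt_compat, Hd).
  assert (Hi : forall a b, ex_RInt v a b)
    by (intros; apply ex_RInt_continuous; intros; apply BUC_continuous).
  set (f := fun t => scal (/ delta) (RInt v t (t + delta))).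
  assert (HL0 : 0 <= 2 * M / delta) by (apply Rmult_le_pos; lra).
  assert (Hlip : forall s t, ndist (f s) (f t) <= 2 * M / delta * Rabs (s - t)).
  { intros s t. destruct (Rle_dec s t) as [Hst|Hst].
    - rewrite Rabs_minus_sym, Rabs_pos_eq by lra. apply moving_average_lipschitz; assumption.
    - rewrite Rabs_pos_eq by lra. rewrite ndist_sym.
      apply moving_average_lipschitz; [exact Hd|lra|exact HM]. }
  assert (Hclose : forall t, ndist (v t) (f t) <= eps).
  { intros t.
    generalize (is_RInt_minus _ _ _ _ _ _ (is_RInt_const t (t + delta) (v t))
      (RInt_correct v t (t + delta) (Hi _ _))). intros H.
    assert (Hn : norm (minus (scal (t + delta - t) (v t)) (RInt v t (t + delta)))
              <= (t + delta - t) * eps).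
    { refine (norm_RInt_le_const _ _ _ _ _ _ _ H); [lra|]. intros x Hx. left.
      apply (Hmod x t). rewrite Rabs_minus_sym, Rabs_pos_eq; unfold delta in Hx; lra. }
    apply (norm_eq_le _ (scal (/ delta)
      (minus (scal (t + delta - t) (v t)) (RInt v t (t + delta))))).
    - unfold f. module_eq; lra.
    - eapply Rle_trans; [apply norm_scal_pos; lra|].
      apply Rle_trans with (/ delta * ((t + delta - t) * eps)).
      + apply Rmult_le_compat_l; [lra|exact Hn].
      + right; field; lra. }
  assert (Hf : is_BUC_R f).
  { apply lipschitz_is_BUC.
    - exists (eps + M). intros t. eapply Rle_trans; [apply (norm_le_ndist _ (v t))|].
      rewrite ndist_sym. generalize (Hclose t) (HM t); lra.
    - exists (2 * M / delta). exact Hlip. }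
  exists (mkBUC X f Hf). split; [exists (2 * M / delta); split; assumption|exact Hclose].
Qed.

End BUCFunctions.

(** Converse of [BUC_quadratic_modulus]. Moduli in this form can be added and scaled, so uniform
    continuity follows from the control inequality without a separate choice of radii for each
    term. *)
Lemma is_BUC_of_quadratic_modulus {X : CompleteNormedModule R_AbsRing} (f : R -> X) :
  bounded_fun f ->
  (forall eps, 0 < eps -> exists C, 0 <= C /\
     forall s t, ndist (f s) (f t) <= eps + C * (s - t) ^ 2) ->
  is_BUC (fun t : R => t) f.
Proof.
  intros Hb Hq. split; [exact Hb|]. intros eps Heps.
  destruct (Hq (eps / 2)) as (C & HC0 & HC); [lra|].
  (* The cap at 1 bounds the square by the absolute value, and [C + 1] covers the case [C = 0]. *)
  set (delta := Rmin 1 (eps / 2 / (C + 1))).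
  assert (Hd : 0 < eps / 2 / (C + 1)) by (apply Rdiv_lt_0_compat; lra).
  assert (Hd1 : delta <= 1) by apply Rmin_l.
  assert (Hd2 : delta <= eps / 2 / (C + 1)) by apply Rmin_r.
  assert (Hd0 : 0 < delta) by (unfold delta; apply Rmin_glb_lt; lra).
  exists delta; split; [exact Hd0|]. intros s t Hst.
  apply Rle_lt_trans with (1 := HC t s).
  assert (Ha : 0 <= Rabs (t - s)) by apply Rabs_pos.
  assert (Hsq : (t - s) ^ 2 <= Rabs (t - s)) by (rewrite <- pow2_abs; nra).
  assert (Hlt : (C + 1) * Rabs (t - s) < (C + 1) * (eps / 2 / (C + 1)))
    by (apply Rmult_lt_compat_l; lra).
  replace ((C + 1) * (eps / 2 / (C + 1))) with (eps / 2) in Hlt by (field; lra).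
  nra.
Qed.

Lemma scaled_quadratic_modulus {X : CompleteNormedModule R_AbsRing} (f : R -> X)
    (a eps : R) : is_BUC (fun t : R => t) f -> 0 <= a -> 0 < eps ->
  exists C, 0 <= C /\ forall s t, ndist (f s) (f t) * a <= eps + C * (s - t) ^ 2.
Proof.
  intros Hf Ha Heps.
  destruct (BUC_quadratic_modulus f (eps / (a + 1)) Hf) as (C & HC0 & HC).
  { apply Rdiv_lt_0_compat; lra. }
  exists (C * a). split; [nra|]. intros s t.
  apply Rle_trans with ((eps / (a + 1) + C * (s - t) ^ 2) * a).
  - apply Rmult_le_compat_r; [exact Ha|apply HC].
  - assert (eps / (a + 1) * a <= eps).
    { apply Rle_trans with (eps / (a + 1) * (a + 1)); [|right; field; lra].
      apply Rmult_le_compat_l; [|lra]. left; apply Rdiv_lt_0_compat; lra. }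
    lra.
Qed.

(** * Consequences of the control inequality *)

Section Evolution.
Context {X : CompleteNormedModule R_AbsRing} {d : delay}.
Context (A : R -> history X d -> mop X) (omega : R).
Context (g h k : R -> X) (K0 : R) (L1 L2 : R -> R).
Context (A_mdiss : forall t phi, m_dissipative (A t phi)).
(** Uniform continuity is what the two control conditions share; Lipschitz bounds are assumed only
    in [lipschitz_history_tame]. *)
Context (g_BUC : is_BUC (fun t : R => t) g) (h_BUC : is_BUC (fun t : R => t) h)
  (k_BUC : is_BUC (fun t : R => t) k).
Context (K0_pos : 0 < K0) (K0_lt : K0 < - omega).
Context (L1_growth : growth_fun L1) (L2_growth : growth_fun L2).
Context (A_control :
  forall lambda t1 t2 (phi1 phi2 : history X d) x1 y1 x2 y2,
    0 < lambda -> A t1 phi1 x1 y1 -> A t2 phi2 x2 y2 ->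
    ndist x1 x2 <=
      norm (minus (minus x1 x2) (scal lambda (minus y1 y2)))
      + lambda * ndist (h t1) (h t2) * L1 (norm x2)
      + lambda * ndist (g t1) (g t2) * norm y2
      + lambda * ndist (k t1) (k t2) * L2 (hnorm phi2)
      + K0 * lambda * hdist phi1 phi2).

(** The error of the control inequality per unit of [lambda], along the histories of one function.
    The weights [a], [b] and [c] stand for bounds on [L1 (norm x2)], [norm y2] and
    [L2 (hnorm phi2)]. *)
Definition defect (a b c : R) (v : BUC X) (s t : R) : R :=
  ndist (h s) (h t) * a + ndist (g s) (g t) * b + ndist (k s) (k t) * c
  + K0 * hdist (segment d v s) (segment d v t).

Lemma hdist_segment_le (v1 v2 : BUC X) (s t D : R) :
  (forall r, ndist (v1 (s + r)) (v2 (t + r)) <= D) ->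
  hdist (segment d v1 s) (segment d v2 t) <= D.
Proof. intros H. apply hdist_le. intros r. apply H. Qed.

Lemma defect_quadratic (a b c eps : R) (v : BUC X) :
  0 <= a -> 0 <= b -> 0 <= c -> 0 < eps ->
  exists C, 0 <= C /\ forall s t, defect a b c v s t <= eps + C * (s - t) ^ 2.
Proof.
  intros Ha Hb Hc Heps. assert (He : 0 < eps / 4) by lra.
  destruct (scaled_quadratic_modulus h a _ h_BUC Ha He) as (Ch & Ch0 & HCh).
  destruct (scaled_quadratic_modulus g b _ g_BUC Hb He) as (Cg & Cg0 & HCg).
  destruct (scaled_quadratic_modulus k c _ k_BUC Hc He) as (Ck & Ck0 & HCk).
  destruct (scaled_quadratic_modulus v K0 _ (BUC_prop _ v) (Rlt_le _ _ K0_pos) He)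
    as (Cv & Cv0 & HCv).
  exists (Ch + Cg + Ck + Cv). split; [lra|]. intros s t.
  assert (Hv : K0 * hdist (segment d v s) (segment d v t) <= eps / 4 + Cv * (s - t) ^ 2).
  { apply Rmult_le_reg_l with (/ K0); [apply Rinv_0_lt_compat, K0_pos|].
    rewrite <- Rmult_assoc, Rinv_l, Rmult_1_l by lra.
    apply hdist_segment_le. intros r. apply Rmult_le_reg_l with K0; [exact K0_pos|].
    rewrite <- Rmult_assoc, Rinv_r, Rmult_1_l by lra.
    generalize (HCv (s + r) (t + r)). replace (s + r - (t + r)) with (s - t) by ring. lra. }
  unfold defect. generalize (HCh s t) (HCg s t) (HCk s t); lra.
Qed.

Lemma ndist_bounded (f : R -> X) : is_BUC (fun t : R => t) f ->
  exists D, 0 <= D /\ forall s t, ndist (f s) (f t) <= D.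
Proof.
  intros Hf. destruct (is_BUC_bound f Hf) as (M & HM0 & HM).
  exists (2 * M); split; [lra|]. intros s t.
  eapply Rle_trans; [apply ndist_le_norm|]. generalize (HM s) (HM t); lra.
Qed.

Lemma defect_bounded (a b c : R) (v : BUC X) : 0 <= a -> 0 <= b -> 0 <= c ->
  exists C, 0 <= C /\ forall s t, defect a b c v s t <= C.
Proof.
  intros Ha Hb Hc.
  destruct (ndist_bounded h h_BUC) as (H & H0 & HH).
  destruct (ndist_bounded g g_BUC) as (G & G0 & HG).
  destruct (ndist_bounded k k_BUC) as (K & Kp & HK).
  destruct (ndist_bounded v (BUC_prop _ v)) as (V & V0 & HV).
  exists (H * a + G * b + K * c + K0 * V). split.
  - generalize (Rmult_le_pos _ _ H0 Ha) (Rmult_le_pos _ _ G0 Hb) (Rmult_le_pos _ _ Kp Hc).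
    nra.
  - intros s t. unfold defect. repeat apply Rplus_le_compat.
    + apply Rmult_le_compat_r; [exact Ha|apply HH].
    + apply Rmult_le_compat_r; [exact Hb|apply HG].
    + apply Rmult_le_compat_r; [exact Hc|apply HK].
    + apply Rmult_le_compat_l; [lra|]. apply hdist_segment_le; intros; apply HV.
Qed.

Lemma growth_mono (L : R -> R) (a b : R) : growth_fun L -> 0 <= a -> a <= b -> L a <= L b.
Proof. intros (_ & _ & H); apply H. Qed.

Lemma growth_nonneg (L : R -> R) (a : R) : growth_fun L -> 0 <= a -> 0 <= L a.
Proof. intros (H & _); apply H. Qed.

(** The slope bound is required only after multiplication by [ndist (g s) (g t)]; for constant [g]
    it therefore holds with any [Y], however large the slopes are. *)
Lemma control_times (v : BUC X) (M Y V nu s t : R) (x1 y1 x2 y2 : X) :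
  0 < nu -> A s (segment d v s) x1 y1 -> A t (segment d v t) x2 y2 ->
  norm x2 <= M -> ndist (g s) (g t) * norm y2 <= ndist (g s) (g t) * Y ->
  (forall r, norm (v r) <= V) ->
  ndist x1 x2 <= norm (minus (minus x1 x2) (scal nu (minus y1 y2)))
    + nu * defect (L1 M) Y (L2 V) v s t.
Proof.
  intros Hnu H1 H2 HM HY HV.
  eapply Rle_trans; [apply (A_control nu _ _ _ _ _ _ _ _ Hnu H1 H2)|].
  unfold defect.
  assert (E1 : ndist (h s) (h t) * L1 (norm x2) <= ndist (h s) (h t) * L1 M).
  { apply Rmult_le_compat_l; [apply ndist_nonneg|].
    apply growth_mono; [exact L1_growth|apply norm_nonneg|exact HM]. }
  assert (E2 : ndist (k s) (k t) * L2 (hnorm (segment d v t)) <= ndist (k s) (k t) * L2 V).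
  { apply Rmult_le_compat_l; [apply ndist_nonneg|].
    destruct (hnorm_bounds (segment d v t) V) as [Hn0 HnV]; [intros r; apply HV|].
    apply growth_mono; [exact L2_growth|exact Hn0|exact HnV]. }
  nra.
Qed.

(** At equal times the terms in [h], [g] and [k] vanish, so no bound on norms or slopes enters. With
    equal histories this is nonexpansiveness of the resolvent. *)
Lemma control_histories (v1 v2 : BUC X) (D nu t : R) (x1 y1 x2 y2 : X) :
  0 < nu -> A t (segment d v1 t) x1 y1 -> A t (segment d v2 t) x2 y2 ->
  (forall r, ndist (v1 r) (v2 r) <= D) ->
  ndist x1 x2 <= norm (minus (minus x1 x2) (scal nu (minus y1 y2))) + nu * (K0 * D).
Proof.
  intros Hnu H1 H2 HD.
  eapply Rle_trans; [apply (A_control nu _ _ _ _ _ _ _ _ Hnu H1 H2)|].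
  rewrite !ndist_refl.
  assert (E : K0 * nu * hdist (segment d v1 t) (segment d v2 t) <= K0 * nu * D).
  { apply Rmult_le_compat_l; [nra|]. apply hdist_segment_le; intros r; apply HD. }
  lra.
Qed.

(** Resolvents are taken separately at each time. Comparison with time 0 bounds [x], the resolvent
    equation then bounds [y], and comparison of two arbitrary times gives the modulus of
    continuity. *)
Lemma resolvent_BUC (nu : R) (v f : BUC X) : 0 < nu ->
  exists x : BUC X, forall t, exists y,
    A t (segment d v t) (x t) y /\ minus (x t) (scal nu y) = f t.
Proof.
  intros Hnu.
  assert (Hex : forall t, exists p : X * X,
    A t (segment d v t) (fst p) (snd p) /\ minus (fst p) (scal nu (snd p)) = f t).
  { intros t. destruct (proj2 (A_mdiss t (segment d v t)) nu Hnu (f t)) as (x & y & H1 & H2).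
    exists (x, y); split; assumption. }
  set (p := fun t => proj1_sig (constructive_indefinite_description _ (Hex t))).
  assert (Hp : forall t, A t (segment d v t) (fst (p t)) (snd (p t)) /\
            minus (fst (p t)) (scal nu (snd (p t))) = f t).
  { intros t. unfold p. destruct (constructive_indefinite_description _ (Hex t)); assumption. }
  clearbody p.
  set (x := fun t => fst (p t)). set (y := fun t => snd (p t)).
  assert (HA : forall t, A t (segment d v t) (x t) (y t)) by (intros t; apply Hp).
  assert (Hf : forall t, minus (x t) (scal nu (y t)) = f t) by (intros t; apply Hp).
  assert (Hxy : forall s t, norm (minus (minus (x s) (x t)) (scal nu (minus (y s) (y t))))
            = ndist (f s) (f t)).
  { intros s t. unfold ndist. f_equal. rewrite <- !Hf. module_eq. }
  destruct (BUC_bound v) as (V & HV0 & HV).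
  destruct (BUC_bound f) as (F & HF0 & HF).
  assert (HL2 : 0 <= L2 V) by (apply growth_nonneg; assumption).
  assert (Hb : exists M, 0 <= M /\ forall t, norm (x t) <= M).
  { destruct (defect_bounded (L1 (norm (x 0))) (norm (y 0)) (L2 V) v) as (C & HC0 & HC);
      [apply growth_nonneg; [exact L1_growth|apply norm_nonneg]|apply norm_nonneg|exact HL2|].
    exists (2 * F + nu * C + norm (x 0)). split; [generalize (norm_nonneg (x 0)); nra|].
    intros t. eapply Rle_trans; [apply (norm_le_ndist _ (x 0))|].
    apply Rplus_le_compat_r.
    eapply Rle_trans.
    - apply (control_times v (norm (x 0)) (norm (y 0)) V nu t 0 _ (y t) _ (y 0));
        auto using Rle_refl.
    - rewrite Hxy. apply Rplus_le_compat.
      + eapply Rle_trans; [apply ndist_le_norm|]. generalize (HF t) (HF 0); lra.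
      + apply Rmult_le_compat_l; [lra|apply HC]. }
  destruct Hb as (M & HM0 & HM).
  (* Since [y] equals [(x - f) / nu], the [g] term is harmless at fixed [nu]; the bound degenerates
     as [nu] tends to 0. *)
  set (Y := (M + F) / nu).
  assert (HY0 : 0 <= Y) by (apply Rmult_le_pos; [lra|left; apply Rinv_0_lt_compat, Hnu]).
  assert (HY : forall t, norm (y t) <= Y).
  { intros t. apply (norm_eq_le _ (scal (/ nu) (minus (x t) (f t)))).
    - rewrite <- Hf. module_eq.
    - eapply Rle_trans; [apply norm_scal_pos; left; apply Rinv_0_lt_compat, Hnu|].
      unfold Y, Rdiv. rewrite Rmult_comm. apply Rmult_le_compat_r.
      + left; apply Rinv_0_lt_compat, Hnu.
      + eapply Rle_trans; [apply ndist_le_norm|]. generalize (HM t) (HF t); lra. }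
  assert (HxB : is_BUC (fun t : R => t) x).
  { apply is_BUC_of_quadratic_modulus; [exists M; exact HM|]. intros eps Heps.
    destruct (BUC_quadratic_modulus f (eps / 2) (BUC_prop _ f)) as (Cf & Cf0 & HCf); [lra|].
    destruct (defect_quadratic (L1 M) Y (L2 V) (eps / (2 * nu)) v) as (C & C0 & HC);
      [apply growth_nonneg; assumption|exact HY0|exact HL2|apply Rdiv_lt_0_compat; lra|].
    exists (Cf + nu * C). split; [nra|]. intros s t.
    eapply Rle_trans.
    - apply (control_times v M Y V nu s t _ (y s) _ (y t)); auto.
      apply Rmult_le_compat_l; [apply ndist_nonneg|apply HY].
    - rewrite Hxy.
      assert (E : nu * defect (L1 M) Y (L2 V) v s t
                  <= nu * (eps / (2 * nu) + C * (s - t) ^ 2))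
        by (apply Rmult_le_compat_l; [lra|apply HC]).
      replace (nu * (eps / (2 * nu) + C * (s - t) ^ 2))
        with (eps / 2 + nu * C * (s - t) ^ 2) in E by (field; lra).
      generalize (HCf s t); lra. }
  exists (mkBUC X x HxB). intros t. exists (y t). split; [apply HA|apply Hf].
Qed.

(** * The Yosida-approximated problem *)

(** The value that the approximate equation forces on the element of [A], so that being a solution
    means that a prescribed pair lies in the graph. *)
Definition approx_slope (lam : R) (w : BUC X) (t : R) : X :=
  minus (scal (/ lam) (minus (w t) (delayed_avg lam w t))) (scal omega (w t)).

Lemma solves_approx_iff (lam : R) (v w : BUC X) :
  solves_approx A omega lam v w <->
  forall t, A t (segment d v t) (w t) (approx_slope lam w t).
Proof.
  assert (E : forall t, yosida_deriv lam w t =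
            scal (/ lam) (minus (w t) (delayed_avg lam w t))) by reflexivity.
  split; intros H t.
  - destruct (H t) as (y & HA & Hy).
    replace (approx_slope lam w t) with y; [exact HA|].
    unfold approx_slope. rewrite <- E, Hy. module_eq.
  - exists (approx_slope lam w t); split; [apply H|].
    rewrite E. unfold approx_slope. module_eq.
Qed.

(** With the step [lam / (1 - lam * omega)] the values of [w1] and [w2] cancel and only their
    averages remain. The factor in front of these is below 1 because [omega] is negative. *)
Lemma resolvent_step (lam : R) (w1 w2 : BUC X) (s t : R) : 0 < lam ->
  minus (minus (w1 s) (w2 t))
    (scal (lam / (1 - lam * omega))
       (minus (approx_slope lam w1 s) (approx_slope lam w2 t))) =
  scal (/ (1 - lam * omega)) (minus (delayed_avg lam w1 s) (delayed_avg lam w2 t)).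
Proof.
  intros Hl. assert (0 < 1 - lam * omega) by nra.
  unfold approx_slope. module_eq; lra.
Qed.

Lemma norm_resolvent_step_le (lam : R) (w1 w2 : BUC X) (s t M : R) : 0 < lam ->
  ndist (delayed_avg lam w1 s) (delayed_avg lam w2 t) <= M ->
  norm (minus (minus (w1 s) (w2 t))
    (scal (lam / (1 - lam * omega))
       (minus (approx_slope lam w1 s) (approx_slope lam w2 t))))
  <= / (1 - lam * omega) * M.
Proof.
  intros Hl HM. assert (Hp : 0 < / (1 - lam * omega)) by (apply Rinv_0_lt_compat; nra).
  eapply norm_eq_le; [apply resolvent_step, Hl|].
  eapply Rle_trans; [apply norm_scal_pos; lra|].
  apply Rmult_le_compat_l; [lra|exact HM].
Qed.

(** For [q = / (1 - lam * omega)] the quotient of the step by [1 - q] is [1 / - omega]: [lam]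
    cancels, and the constant is uniform in [lam]. *)
Lemma approx_solution_dist (lam D : R) (v1 v2 w1 w2 : BUC X) : 0 < lam ->
  solves_approx A omega lam v1 w1 -> solves_approx A omega lam v2 w2 ->
  (forall r, ndist (v1 r) (v2 r) <= D) ->
  forall t, ndist (w1 t) (w2 t) <= K0 / - omega * D.
Proof.
  intros Hl Hw1 Hw2 HD t. rewrite solves_approx_iff in Hw1, Hw2.
  assert (Hden : 1 < 1 - lam * omega) by nra.
  assert (Hnu : 0 < lam / (1 - lam * omega)) by (apply Rdiv_lt_0_compat; lra).
  replace (K0 / - omega * D) with
    (lam / (1 - lam * omega) * (K0 * D) / (1 - / (1 - lam * omega))).
  2: { field. repeat split; nra. }
  apply (le_of_affine_improvement (fun t => ndist (w1 t) (w2 t))).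
  - rewrite <- Rinv_1. apply Rinv_lt_contravar; lra.
  - destruct (BUC_dist_bound w1 w2) as (M & _ & HM). exists M; exact HM.
  - intros M HM s.
    eapply Rle_trans; [apply (control_histories v1 v2 D _ s _ _ _ _ Hnu (Hw1 s) (Hw2 s) HD)|].
    apply Rplus_le_compat_r, norm_resolvent_step_le; [exact Hl|].
    replace M with (M + 0 * lam + 2 * 0 * lam ^ 2) by ring.
    apply delayed_avg_minus_le; [exact Hl|]. intros r _. generalize (HM (s - r)); lra.
Qed.

Lemma approx_solution_exists (lam : R) (v : BUC X) : 0 < lam ->
  exists w : BUC X, unique_solves_approx A omega lam v w.
Proof.
  intros Hl.
  assert (Hden : 1 < 1 - lam * omega) by nra.
  set (q := / (1 - lam * omega)).
  assert (Hq0 : 0 < q) by (apply Rinv_0_lt_compat; lra).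
  assert (Hq1 : q < 1) by (unfold q; rewrite <- Rinv_1; apply Rinv_lt_contravar; lra).
  set (nu := lam / (1 - lam * omega)).
  assert (Hnu : 0 < nu) by (apply Rdiv_lt_0_compat; lra).
  (* The approximate equation in fixed-point form: its solutions are the [w] for which [x = w] is
     possible here. *)
  assert (Hstep : forall w : BUC X, exists x : BUC X, forall t, exists y,
    A t (segment d v t) (x t) y /\ minus (x t) (scal nu y) = scal q (delayed_avg lam w t)).
  { intros w.
    assert (Hf : is_BUC (fun t : R => t) (fun t => scal q (delayed_avg lam w t))).
    { generalize (delayed_avg_is_BUC lam w Hl). intros HJ.
      apply is_BUC_of_quadratic_modulus.
      - destruct (is_BUC_bound _ HJ) as (M & _ & HM). exists (q * M). intros t.
        eapply Rle_trans; [apply norm_scal_pos; lra|].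
        apply Rmult_le_compat_l; [lra|apply HM].
      - intros eps Heps. destruct (BUC_quadratic_modulus _ eps HJ Heps) as (C & HC0 & HC).
        exists C; split; [exact HC0|]. intros s t. unfold ndist.
        apply (norm_eq_le _ (scal q (minus (delayed_avg lam w s) (delayed_avg lam w t))));
          [module_eq|].
        eapply Rle_trans; [apply norm_scal_pos; lra|].
        eapply Rle_trans; [|apply HC].
        rewrite <- (Rmult_1_l (ndist _ _)).
        apply Rmult_le_compat_r; [apply norm_nonneg|lra]. }
    exact (resolvent_BUC nu v (mkBUC X _ Hf) Hnu). }
  set (T := fun w => proj1_sig (constructive_indefinite_description _ (Hstep w))).
  assert (HT : forall w t, exists y, A t (segment d v t) (T w t) y /\
    minus (T w t) (scal nu y) = scal q (delayed_avg lam w t)).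
  { intros w. unfold T. destruct (constructive_indefinite_description _ (Hstep w)); assumption. }
  clearbody T.
  destruct (BUC_contraction_fixed_point T q) as (w & Hw & _); [lra| |].
  { intros D w1 w2 HD t.
    destruct (HT w1 t) as (y1 & HA1 & Hy1). destruct (HT w2 t) as (y2 & HA2 & Hy2).
    eapply Rle_trans.
    - apply (control_histories v v 0 nu t _ y1 _ y2 Hnu HA1 HA2).
      intros r; rewrite ndist_refl; lra.
    - rewrite 2!Rmult_0_r, Rplus_0_r.
      apply (norm_eq_le _ (scal q (minus (delayed_avg lam w1 t) (delayed_avg lam w2 t)))).
      + transitivity (minus (minus (T w1 t) (scal nu y1)) (minus (T w2 t) (scal nu y2))).
        * module_eq.
        * rewrite Hy1, Hy2. module_eq.
      + eapply Rle_trans; [apply norm_scal_pos; lra|].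
        apply Rmult_le_compat_l; [lra|].
        replace D with (D + 0 * lam + 2 * 0 * lam ^ 2) by ring.
        apply delayed_avg_minus_le; [exact Hl|]. intros r _. generalize (HD (t - r)); lra. }
  assert (Hsol : solves_approx A omega lam v w).
  { apply solves_approx_iff. intros t. destruct (HT w t) as (y & HA & Hy).
    rewrite Hw in HA, Hy.
    replace (approx_slope lam w t) with y; [exact HA|].
    transitivity (scal (/ nu) (minus (w t) (minus (w t) (scal nu y)))); [module_eq; lra|].
    rewrite Hy. unfold approx_slope, nu, q. module_eq; lra. }
  exists w; split; [exact Hsol|]. intros w' Hw' t. apply ndist_eq.
  (* Uniqueness is continuous dependence on the history at distance [D = 0]. *)
  replace 0 with (K0 / - omega * 0) by ring.
  apply (approx_solution_dist lam 0 v v); try assumption.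
  intros r; rewrite ndist_refl; lra.
Qed.

(** All solutions are compared with one fixed pair of [A] at time 0, chosen before [lam]; the step
    divided by [1 - q] is again [1 / - omega]. *)
Lemma approx_solution_bounded (v : BUC X) :
  exists M, 0 <= M /\ forall lam w, 0 < lam -> solves_approx A omega lam v w ->
    forall t, norm (w t) <= M.
Proof.
  destruct (proj2 (A_mdiss 0 (segment d v 0)) 1 Rlt_0_1 zero) as (x0 & y0 & HA0 & _).
  destruct (BUC_bound v) as (V & HV0 & HV).
  destruct (defect_bounded (L1 (norm x0)) (norm y0) (L2 V) v) as (C & HC0 & HC);
    [apply growth_nonneg; [exact L1_growth|apply norm_nonneg]|apply norm_nonneg
    |apply growth_nonneg; assumption|].
  (* [z0] is the residue of the constant [x0] in the equation: the difference of [w] and [x0], minus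
     [nu] times that of their slopes, is [q] times the averaged difference plus [nu] times [z0]. *)
  set (z0 := plus y0 (scal omega x0)).
  set (B := (norm z0 + C) / - omega).
  assert (HB0 : 0 <= B).
  { apply Rmult_le_pos; [generalize (norm_nonneg z0); lra|].
    left; apply Rinv_0_lt_compat; lra. }
  exists (B + norm x0). split; [generalize (norm_nonneg x0); lra|].
  intros lam w Hl Hw t. rewrite solves_approx_iff in Hw.
  eapply Rle_trans; [apply (norm_le_ndist _ x0)|]. apply Rplus_le_compat_r.
  assert (Hden : 1 < 1 - lam * omega) by nra.
  set (q := / (1 - lam * omega)).
  assert (Hq0 : 0 < q) by (apply Rinv_0_lt_compat; lra).
  set (nu := lam / (1 - lam * omega)).
  assert (Hnu : 0 < nu) by (apply Rdiv_lt_0_compat; lra).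
  replace B with (nu * (norm z0 + C) / (1 - q)).
  2: { unfold B, nu, q. field. repeat split; nra. }
  apply (le_of_affine_improvement (fun t => ndist (w t) x0)).
  - unfold q; rewrite <- Rinv_1; apply Rinv_lt_contravar; lra.
  - destruct (BUC_bound w) as (M & _ & HM). exists (M + norm x0). intros s.
    eapply Rle_trans; [apply ndist_le_norm|]. generalize (HM s); lra.
  - intros M HM s.
    eapply Rle_trans.
    + apply (control_times v (norm x0) (norm y0) V nu s 0 _ (approx_slope lam w s) _ y0);
        auto using Rle_refl.
    + rewrite Rmult_plus_distr_l, <- Rplus_assoc. apply Rplus_le_compat.
      * apply (norm_eq_le _ (plus (scal q (minus (delayed_avg lam w s) x0)) (scal nu z0))).
        { unfold approx_slope, q, nu, z0. module_eq; lra. }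
        eapply Rle_trans; [apply norm_plus_le|]. apply Rplus_le_compat.
        -- eapply Rle_trans; [apply norm_scal_pos; lra|]. apply Rmult_le_compat_l; [lra|].
           replace M with (M + 0 * lam + 2 * 0 * lam ^ 2) by ring.
           apply delayed_avg_minus_const_le; [exact Hl|].
           intros r _. generalize (HM (s - r)); lra.
        -- apply norm_scal_pos; lra.
      * apply Rmult_le_compat_l; [lra|apply HC].
Qed.

(* [b (s - t)^2] satisfies the doubled equation up to the error [2 b (lam + mu)],
   because the second moment of the exponential law with mean [lam] is [2 lam^2]. *)
Lemma doubled_estimate (v w1 w2 : BUC X) (lam mu M Y V e C : R) :
  0 < lam -> 0 < mu -> 0 <= C ->
  solves_approx A omega lam v w1 -> solves_approx A omega mu v w2 ->
  (forall t, norm (w2 t) <= M) ->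
  (forall s t, ndist (g s) (g t) * norm (approx_slope mu w2 t) <= ndist (g s) (g t) * Y) ->
  (forall r, norm (v r) <= V) ->
  (forall s t, defect (L1 M) Y (L2 V) v s t <= e + C * (s - t) ^ 2) ->
  forall t, ndist (w1 t) (w2 t) <= (e + 2 * (C / - omega) * (lam + mu)) / - omega.
Proof.
  intros Hl Hm HC0 Hw1 Hw2 HM HY HV HC t. rewrite solves_approx_iff in Hw1, Hw2.
  assert (Hil : 0 < / lam) by (apply Rinv_0_lt_compat, Hl).
  assert (Him : 0 < / mu) by (apply Rinv_0_lt_compat, Hm).
  (* Chosen so that the zero-order term [- omega * b * (s - r) ^ 2] absorbs the error
     [C * (s - r) ^ 2]. *)
  set (b := C / - omega).
  assert (Hb0 : 0 <= b) by (apply Rmult_le_pos; [exact HC0|left; apply Rinv_0_lt_compat; lra]).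
  assert (HCb : C = - omega * b) by (unfold b; field; lra).
  (* The step [/ S] is the one for which the resolvent difference splits exactly into [nu * / mu]
     and [nu * / lam] multiples of differences in which only one of the two solutions is
     averaged. *)
  set (S := / lam + / mu - omega).
  assert (HS : 0 < S) by (unfold S; lra).
  set (nu := / S). assert (Hnu : 0 < nu) by (apply Rinv_0_lt_compat, HS).
  assert (HnS : nu * S = 1) by (unfold nu; apply Rinv_l; lra).
  assert (HnS' : nu * / lam + nu * / mu - nu * omega = 1) by (rewrite <- HnS; unfold S; ring).
  (* Subtracting the quadratic keeps the function bounded above on the plane, and each upper bound
     [N] gives a quadratic majorant of the distance with the same [b]. *)
  assert (Hmain : forall p : R * R,
    ndist (w1 (fst p)) (w2 (snd p)) - b * (fst p - snd p) ^ 2 <=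
    (nu * (e + 2 * b * (lam + mu))) / (1 - nu * (/ lam + / mu))).
  { apply le_of_affine_improvement.
    - nra.
    - destruct (BUC_bound w1) as (M1 & _ & HM1). exists (M1 + M). intros [s r]; simpl fst; simpl snd.
      assert (0 <= b * (s - r) ^ 2) by (apply Rmult_le_pos; [exact Hb0|apply pow2_ge_0]).
      generalize (ndist_le_norm (w1 s) (w2 r)) (HM1 s) (HM r); lra.
    - intros N HN [s r]. simpl fst; simpl snd.
      assert (HN' : forall s r, ndist (w1 s) (w2 r) <= N + b * (s - r) ^ 2)
        by (intros s' r'; generalize (HN (s', r')); simpl fst; simpl snd; lra).
      assert (H1 : ndist (w1 s) (delayed_avg mu w2 r) <=
                (N + b * (s - r) ^ 2) + 2 * b * (s - r) * mu + 2 * b * mu ^ 2).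
      { rewrite ndist_sym. apply delayed_avg_minus_const_le; [exact Hm|].
        intros x _. rewrite ndist_sym. eapply Rle_trans; [apply HN'|]. right; ring. }
      assert (H2 : ndist (delayed_avg lam w1 s) (w2 r) <=
                (N + b * (s - r) ^ 2) + - (2 * b * (s - r)) * lam + 2 * b * lam ^ 2).
      { apply delayed_avg_minus_const_le; [exact Hl|].
        intros x _. eapply Rle_trans; [apply HN'|]. right; ring. }
      assert (H3 : ndist (w1 s) (w2 r) <=
        nu * / mu * ndist (w1 s) (delayed_avg mu w2 r) +
        nu * / lam * ndist (delayed_avg lam w1 s) (w2 r) + nu * (e + C * (s - r) ^ 2)).
      { eapply Rle_trans.
        - apply (control_times v M Y V nu s r _ (approx_slope lam w1 s) _ (approx_slope mu w2 r));
            auto.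
        - apply Rplus_le_compat; [|apply Rmult_le_compat_l; [lra|apply HC]].
          apply (norm_eq_le _
            (plus (scal (nu * / mu) (minus (w1 s) (delayed_avg mu w2 r)))
                  (scal (nu * / lam) (minus (delayed_avg lam w1 s) (w2 r))))).
          + unfold approx_slope.
            replace omega with (/ lam + / mu - / nu)
              by (unfold nu; rewrite Rinv_inv; unfold S; ring).
            module_eq; lra.
          + eapply Rle_trans; [apply norm_plus_le|].
            apply Rplus_le_compat; apply norm_scal_pos; nra. }
      (* The drifts [2 * b * (s - r)] of this bound and of the next have opposite signs and cancel
         in the sum, which leaves [nu * (2 * b * (lam + mu))]. *)
      assert (H1' : nu * / mu * ndist (w1 s) (delayed_avg mu w2 r) <=
        nu * / mu * (N + b * (s - r) ^ 2) + nu * (2 * b * (s - r) + 2 * b * mu)).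
      { apply Rle_trans with (nu * / mu *
          ((N + b * (s - r) ^ 2) + 2 * b * (s - r) * mu + 2 * b * mu ^ 2)).
        - apply Rmult_le_compat_l; [nra|exact H1].
        - right; field; lra. }
      assert (H2' : nu * / lam * ndist (delayed_avg lam w1 s) (w2 r) <=
        nu * / lam * (N + b * (s - r) ^ 2) + nu * (- (2 * b * (s - r)) + 2 * b * lam)).
      { apply Rle_trans with (nu * / lam *
          ((N + b * (s - r) ^ 2) + - (2 * b * (s - r)) * lam + 2 * b * lam ^ 2)).
        - apply Rmult_le_compat_l; [nra|exact H2].
        - right; field; lra. }
      rewrite HCb in H3.
      assert (Hid : b * (s - r) ^ 2 =
        (nu * / lam + nu * / mu - nu * omega) * (b * (s - r) ^ 2)) by (rewrite HnS'; ring).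
      lra. }
  generalize (Hmain (t, t)); simpl fst; simpl snd.
  replace (1 - nu * (/ lam + / mu)) with (nu * - omega) by lra.
  replace (nu * (e + 2 * b * (lam + mu)) / (nu * - omega))
    with ((e + 2 * b * (lam + mu)) / - omega) by (field; lra).
  replace (b * (t - t) ^ 2) with 0 by ring. lra.
Qed.

(* The factor [ndist (g s) (g t)] makes every history tame when [g] is constant. *)
Definition tame_history (v : BUC X) : Prop :=
  exists Y, 0 <= Y /\ forall lam w, 0 < lam -> solves_approx A omega lam v w ->
    forall s t, ndist (g s) (g t) * norm (approx_slope lam w t) <= ndist (g s) (g t) * Y.

(** * The Cauchy property as [lam] tends to 0 *)

Definition approx_cauchy (v : BUC X) : Prop :=
  forall eps, 0 < eps -> exists delta, 0 < delta /\
    forall lam mu w1 w2, 0 < lam < delta -> 0 < mu < delta ->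
      solves_approx A omega lam v w1 -> solves_approx A omega mu v w2 ->
      forall t, ndist (w1 t) (w2 t) <= eps.

(** This bound degenerates as [lam] tends to 0. It provides the a priori finiteness that
    [le_of_affine_improvement] asks for. *)
Lemma approx_slope_bounded (lam : R) (w : BUC X) : 0 < lam ->
  exists N, forall t, norm (approx_slope lam w t) <= N.
Proof.
  intros Hl. destruct (BUC_bound w) as (M & _ & HM).
  destruct (is_BUC_bound _ (delayed_avg_is_BUC lam w Hl)) as (M' & _ & HM').
  exists (/ lam * (M + M') + Rabs omega * M). intros t.
  eapply Rle_trans; [apply ndist_le_norm|]. apply Rplus_le_compat.
  - assert (Hil : 0 < / lam) by (apply Rinv_0_lt_compat, Hl).
    eapply Rle_trans; [apply norm_scal_pos; lra|]. apply Rmult_le_compat_l; [lra|].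
    eapply Rle_trans; [apply ndist_le_norm|]. generalize (HM t) (HM' t); lra.
  - eapply Rle_trans; [apply norm_scal_le|].
    apply Rmult_le_compat_l; [apply Rabs_pos|apply HM].
Qed.

(* A bound [N] on the slopes makes [w] Lipschitz with constant [(C + Lg N) / - omega],
   which in turn bounds the slopes by an affine function of [N] of rate [Lg / - omega < 1]. *)
Lemma lipschitz_history_tame (Lg Lh Lk Lv : R) (v : BUC X) :
  0 <= Lg -> Lg < - omega -> 0 <= Lh -> 0 <= Lk -> 0 <= Lv ->
  (forall s t, ndist (g s) (g t) <= Lg * Rabs (s - t)) ->
  (forall s t, ndist (h s) (h t) <= Lh * Rabs (s - t)) ->
  (forall s t, ndist (k s) (k t) <= Lk * Rabs (s - t)) ->
  (forall s t, ndist (v s) (v t) <= Lv * Rabs (s - t)) ->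
  tame_history v.
Proof.
  intros Lg0 Lg1 Lh0 Lk0 Lv0 Hg Hh Hk Hv.
  destruct (approx_solution_bounded v) as (M & HM0 & HM).
  destruct (BUC_bound v) as (V & HV0 & HV).
  assert (HL1 : 0 <= L1 M) by (apply growth_nonneg; assumption).
  assert (HL2 : 0 <= L2 V) by (apply growth_nonneg; assumption).
  set (C := Lh * L1 M + Lk * L2 V + K0 * Lv).
  assert (HC0 : 0 <= C).
  { unfold C. generalize (Rmult_le_pos _ _ Lh0 HL1) (Rmult_le_pos _ _ Lk0 HL2). nra. }
  assert (Hdef : forall N s t, 0 <= N ->
    defect (L1 M) N (L2 V) v s t <= (C + Lg * N) * Rabs (s - t)).
  { intros N s t HN. unfold defect, C.
    assert (E1 : hdist (segment d v s) (segment d v t) <= Lv * Rabs (s - t)).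
    { apply hdist_segment_le. intros r. eapply Rle_trans; [apply Hv|].
      replace (s + r - (t + r)) with (s - t) by ring. apply Rle_refl. }
    generalize (Rmult_le_compat_r _ _ _ HL1 (Hh s t)) (Rmult_le_compat_r _ _ _ HL2 (Hk s t))
      (Rmult_le_compat_r _ _ _ HN (Hg s t))
      (Rmult_le_compat_l _ _ _ (Rlt_le _ _ K0_pos) E1).
    lra. }
  set (al := - omega). assert (Hal : 0 < al) by (unfold al; lra).
  (* The fixed point of [N] to [(C + Lg * N) / al + al * M], the improved slope bound obtained
     below. *)
  set (Y := (C / al + al * M) / (1 - Lg / al)).
  assert (Hq : Lg / al < 1).
  { apply Rmult_lt_reg_r with al; [exact Hal|]. unfold Rdiv.
    rewrite Rmult_assoc, Rinv_l by lra. unfold al; lra. }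
  assert (HY0 : 0 <= Y).
  { unfold Y. assert (0 <= C / al) by (apply Rmult_le_pos; [exact HC0|left; apply Rinv_0_lt_compat; lra]).
    apply Rmult_le_pos; [nra|left; apply Rinv_0_lt_compat; lra]. }
  exists Y; split; [exact HY0|].
  intros lam w Hl Hw s t. apply Rmult_le_compat_l; [apply ndist_nonneg|].
  revert t. generalize (HM lam w Hl Hw); intros HMw.
  rewrite solves_approx_iff in Hw.
  apply (le_of_affine_improvement (fun t => norm (approx_slope lam w t))); [exact Hq|
    apply approx_slope_bounded, Hl|].
  intros N HN t.
  assert (HN0 : 0 <= N) by (eapply Rle_trans; [apply (norm_nonneg (approx_slope lam w 0))|apply HN]).
  set (Lw := (C + Lg * N) / al).
  (* [w] is compared with its own translate by [r]. The time shift is constant along the comparison,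
     so the defect is at most [(C + Lg * N) * r] throughout. *)
  assert (Hlip : forall r, 0 <= r -> forall t, ndist (w (t - r)) (w t) <= Lw * r).
  { intros r Hr.
    assert (Hden : 1 < 1 - lam * omega) by nra.
    assert (Hnu : 0 < lam / (1 - lam * omega)) by (apply Rdiv_lt_0_compat; lra).
    replace (Lw * r) with
      (lam / (1 - lam * omega) * ((C + Lg * N) * r) / (1 - / (1 - lam * omega))).
    2: { unfold Lw, al. field. repeat split; nra. }
    apply (le_of_affine_improvement (fun t => ndist (w (t - r)) (w t))).
    - rewrite <- Rinv_1. apply Rinv_lt_contravar; lra.
    - exists (M + M). intros s'. eapply Rle_trans; [apply ndist_le_norm|].
      generalize (HMw (s' - r)) (HMw s'); lra.
    - intros P HP s'.
      eapply Rle_trans.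
      + apply (control_times v M N V _ (s' - r) s' _ _ _ _ Hnu (Hw (s' - r)) (Hw s')); auto.
        apply Rmult_le_compat_l; [apply ndist_nonneg|apply HN].
      + apply Rplus_le_compat.
        * apply norm_resolvent_step_le; [exact Hl|].
          replace P with (P + 0 * lam + 2 * 0 * lam ^ 2) by ring.
          apply delayed_avg_minus_le; [exact Hl|]. intros x _.
          generalize (HP (s' - x)). replace (s' - x - r) with (s' - r - x) by ring. lra.
        * apply Rmult_le_compat_l; [lra|].
          eapply Rle_trans; [apply Hdef, HN0|]. right.
          replace (s' - r - s') with (- r) by ring.
          rewrite Rabs_Ropp, Rabs_pos_eq by exact Hr. reflexivity. }
  assert (Havg : ndist (w t) (delayed_avg lam w t) <= Lw * lam).
  { rewrite ndist_sym. replace (Lw * lam) with (0 + Lw * lam + 2 * 0 * lam ^ 2) by ring.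
    apply delayed_avg_minus_const_le; [exact Hl|]. intros r Hr.
    generalize (Hlip r Hr t); lra. }
  assert (Hil : 0 < / lam) by (apply Rinv_0_lt_compat, Hl).
  apply Rle_trans with (/ lam * (Lw * lam) + al * M).
  - apply (norm_eq_le _ (plus (scal (/ lam) (minus (w t) (delayed_avg lam w t)))
                              (scal al (w t)))).
    { unfold approx_slope, al. module_eq. }
    eapply Rle_trans; [apply norm_plus_le|]. apply Rplus_le_compat.
    + eapply Rle_trans; [apply norm_scal_pos; lra|]. apply Rmult_le_compat_l; [lra|exact Havg].
    + eapply Rle_trans; [apply norm_scal_pos; lra|]. apply Rmult_le_compat_l; [lra|apply HMw].
  - right. unfold Lw. field. split; lra.
Qed.

(** Half of the error comes from the additive part of the quadratic modulus, which fixes [C]; only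
    then are [lam] and [mu] made small relative to [C]. *)
Lemma tame_history_cauchy (v : BUC X) : tame_history v -> approx_cauchy v.
Proof.
  intros (Y & HY0 & HY) eps Heps.
  destruct (approx_solution_bounded v) as (M & HM0 & HM).
  destruct (BUC_bound v) as (V & HV0 & HV).
  set (al := - omega). assert (Hal : 0 < al) by (unfold al; lra).
  destruct (defect_quadratic (L1 M) Y (L2 V) (al * eps / 2) v) as (C & HC0 & HC);
    [apply growth_nonneg; assumption|exact HY0|apply growth_nonneg; assumption|nra|].
  set (b := C / al).
  assert (Hb0 : 0 <= b) by (apply Rmult_le_pos; [exact HC0|left; apply Rinv_0_lt_compat; lra]).
  (* With this choice [2 * b * (lam + mu)] is at most [al * eps / 2]; [b + 1] avoids division by
     0. *)
  exists (al * eps / (8 * (b + 1))). split; [apply Rdiv_lt_0_compat; nra|].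
  intros lam mu w1 w2 [Hl Hld] [Hm Hmd] Hw1 Hw2 t.
  eapply Rle_trans.
  - apply (doubled_estimate v w1 w2 lam mu M Y V (al * eps / 2) C); eauto.
  - fold al. fold b.
    assert (E : forall x, x < al * eps / (8 * (b + 1)) -> (b + 1) * x <= al * eps / 8).
    { intros x Hx. replace (al * eps / 8) with ((b + 1) * (al * eps / (8 * (b + 1))))
        by (field; lra). apply Rmult_le_compat_l; lra. }
    generalize (E _ Hld) (E _ Hmd); intros.
    apply Rmult_le_reg_r with al; [exact Hal|].
    unfold Rdiv at 1. rewrite Rmult_assoc, Rinv_l, Rmult_1_r by lra.
    nra.
Qed.

Lemma approx_cauchy_closed (v : BUC X) :
  (forall eps, 0 < eps -> exists v', approx_cauchy v' /\ forall t, ndist (v t) (v' t) <= eps) ->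
  approx_cauchy v.
Proof.
  intros H eps Heps.
  assert (Hc : 0 < K0 / - omega < 1).
  { split; [apply Rdiv_lt_0_compat; lra|].
    apply Rmult_lt_reg_r with (- omega); [lra|]. unfold Rdiv.
    rewrite Rmult_assoc, Rinv_l by lra. lra. }
  destruct (H (eps / 3)) as (v' & Hv' & Hd); [lra|].
  destruct (Hv' (eps / 3)) as (delta & Hdel & Hcl); [lra|].
  exists delta; split; [exact Hdel|]. intros lam mu w1 w2 Hl Hm Hw1 Hw2 t.
  destruct (approx_solution_exists lam v' (proj1 Hl)) as (w1' & Hw1' & _).
  destruct (approx_solution_exists mu v' (proj1 Hm)) as (w2' & Hw2' & _).
  generalize (approx_solution_dist lam _ v v' w1 w1' (proj1 Hl) Hw1 Hw1' Hd t).
  generalize (approx_solution_dist mu _ v v' w2 w2' (proj1 Hm) Hw2 Hw2' Hd t).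
  generalize (Hcl lam mu w1' w2' Hl Hm Hw1' Hw2' t).
  generalize (ndist_triangle (w1' t) (w1 t) (w2 t)) (ndist_triangle (w2' t) (w1' t) (w2 t)).
  rewrite (ndist_sym (w2' t) (w2 t)). nra.
Qed.

Lemma solution_of_approx_cauchy : (forall v, approx_cauchy v) ->
  exists u : R -> X, is_BUC (fun t : R => t) u /\ is_solution A omega u.
Proof.
  intros Hcauchy.
  set (q := K0 / - omega).
  assert (Hq : 0 < q < 1).
  { split; [apply Rdiv_lt_0_compat; lra|].
    apply Rmult_lt_reg_r with (- omega); [lra|]. unfold q, Rdiv.
    rewrite Rmult_assoc, Rinv_l by lra. lra. }
  (* The condition on [lam] is moved under the existential so that choice yields a total map; for
     nonpositive [lam] its value is arbitrary. *)
  assert (HTex : forall lam v, exists w : BUC X, 0 < lam -> unique_solves_approx A omega lam v w).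
  { intros lam v. destruct (Rlt_dec 0 lam) as [Hl|Hl].
    - destruct (approx_solution_exists lam v Hl) as [w Hw]. exists w; auto.
    - exists v; intros H; contradiction. }
  set (T := fun lam v => proj1_sig (constructive_indefinite_description _ (HTex lam v))).
  assert (HT : forall lam v, 0 < lam -> unique_solves_approx A omega lam v (T lam v)).
  { intros lam v. unfold T.
    destruct (constructive_indefinite_description _ (HTex lam v)); assumption. }
  clearbody T.
  assert (HTd : forall lam (v1 v2 : BUC X) D, 0 < lam -> (forall t, ndist (v1 t) (v2 t) <= D) ->
    forall t, ndist (T lam v1 t) (T lam v2 t) <= q * D).
  { intros lam v1 v2 D Hl HD. apply (approx_solution_dist lam D v1 v2); auto;
      apply HT, Hl. }
  assert (Hright : forall delta, 0 < delta -> at_right 0 (fun lam => 0 < lam < delta)).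
  { intros delta Hd. exists (mkposreal delta Hd). intros lam Hlam Hpos.
    split; [exact Hpos|].
    assert (Hab : Rabs (lam - 0) < delta) by exact Hlam.
    rewrite Rminus_0_r in Hab. apply Rle_lt_trans with (2 := Hab), Rle_abs. }
  assert (HSex : forall v, exists w : BUC X,
    unif_lim (at_right 0) (fun lam => BUC_fun X (T lam v)) w).
  { intros v.
    destruct (unif_cauchy_lim (at_right 0) (fun lam => BUC_fun X (T lam v))) as [l Hl].
    - intros eps Heps. destruct (Hcauchy v eps Heps) as (delta & Hd & H).
      exists (fun lam => 0 < lam < delta). split; [apply Hright, Hd|].
      intros lam mu Hlam Hmu t. apply (H lam mu); try assumption; apply HT; tauto.
    - exists (mkBUC X l (unif_lim_is_BUC _ _ _ Hl)). exact Hl. }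
  set (S := fun v => proj1_sig (constructive_indefinite_description _ (HSex v))).
  assert (HS : forall v, unif_lim (at_right 0) (fun lam => BUC_fun X (T lam v)) (S v)).
  { intros v. unfold S.
    destruct (constructive_indefinite_description _ (HSex v)); assumption. }
  clearbody S.
  destruct (BUC_contraction_fixed_point S q) as (u & _ & Hu); [lra| |].
  { intros D v1 v2 HD. apply (unif_lim_dist_le _ _ _ _ _ _ (HS v1) (HS v2)).
    apply filter_imp with (2 := Hright 1 Rlt_0_1). intros lam [Hlam _]. apply HTd; assumption. }
  exists u; split; [apply BUC_prop|]. intros psi.
  exists (fun n lam => Nat.iter n (T lam) psi). split.
  { intros lam Hlam. split; [reflexivity|]. intros n. apply HT, Hlam. }
  exists (fun n => BUC_fun X (Nat.iter n S psi)). split; [|apply Hu].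
  (* Stage [n + 1] goes through [T lam] applied to the limit [S^n psi]: the induction hypothesis
     contributes at most [q * (eps / 2)], uniformly in [lam], and the definition of [S] contributes
     less than [eps / 2]. *)
  induction n as [|n IH]; intros eps Heps.
  - apply filter_forall. intros lam t. exact (Rle_lt_trans _ _ _ (Req_le _ _ (ndist_refl _)) Heps).
  - assert (He2 : 0 < eps / 2) by lra.
    generalize (filter_and _ _ (filter_and _ _ (unif_lim_ndist _ _ _ _ IH He2)
      (unif_lim_ndist _ _ _ _ (HS (Nat.iter n S psi)) He2)) (Hright 1 Rlt_0_1)).
    apply filter_imp. intros lam [[H1 H2] [Hlam _]] t.
    assert (H3 : ndist (T lam (Nat.iter n (T lam) psi) t) (T lam (Nat.iter n S psi) t)
              <= q * (eps / 2)).
    { apply HTd; [exact Hlam|]. intros r; left; apply H1. }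
    generalize (H2 t) (ndist_triangle (T lam (Nat.iter n S psi) t)
      (T lam (Nat.iter n (T lam) psi) t) (S (Nat.iter n S psi) t)).
    intros H4 H5.
    apply Rle_lt_trans with (1 := H5). nra.
Qed.

End Evolution.

(** * The two control conditions *)

Theorem theorem3p4 (X : CompleteNormedModule R_AbsRing) (d : delay) (omega : R)
    (A : R -> history X d -> mop X)
    (A_mdiss : forall (t : R) (phi : history X d), m_dissipative (A t phi))
    (A_control :
      (exists (h k : R -> X) (K0 : R) (L1 L2 : R -> R),
         uc_control A h k K0 L1 L2 /\ K0 < - omega) \/
      (exists (g h k : R -> X) (K0 : R) (L1 L2 : R -> R),
         lip_control A g h k K0 L1 L2 /\ Rmax K0 (lip_const g) < - omega)) :
  exists u : R -> X, is_BUC (fun t : R => t) u /\ is_solution A omega u.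
Proof.
  destruct A_control as
    [(h & k & K0 & L1 & L2 & (Hh & Hk & HK0 & HL1 & HL2 & Hc) & HK)
    |(g & h & k & K0 & L1 & L2 & ([Hgb Hg] & [Hhb Hh] & [Hkb Hk] & HK0 & HL1 & HL2 & Hc) & HK)].
  - set (g := fun _ : R => zero : X).
    assert (Hc' : forall lambda t1 t2 (phi1 phi2 : history X d) x1 y1 x2 y2,
      0 < lambda -> A t1 phi1 x1 y1 -> A t2 phi2 x2 y2 ->
      ndist x1 x2 <=
        norm (minus (minus x1 x2) (scal lambda (minus y1 y2)))
        + lambda * ndist (h t1) (h t2) * L1 (norm x2)
        + lambda * ndist (g t1) (g t2) * norm y2
        + lambda * ndist (k t1) (k t2) * L2 (hnorm phi2)
        + K0 * lambda * hdist phi1 phi2).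
    { intros lambda t1 t2 phi1 phi2 x1 y1 x2 y2 Hl H1 H2.
      unfold g. rewrite ndist_refl, Rmult_0_r, Rmult_0_l, Rplus_0_r.
      exact (Hc lambda t1 t2 phi1 phi2 x1 y1 x2 y2 Hl H1 H2). }
    apply (solution_of_approx_cauchy A omega g h k K0 L1 L2); try assumption;
      [apply is_BUC_const|].
    intros v. apply (tame_history_cauchy A omega g h k K0 L1 L2); try assumption;
      [apply is_BUC_const|].
    (* For [g = 0] both sides of the tameness inequality vanish, so every history is tame and no
       Lipschitz approximation is called for. *)
    exists 0; split; [lra|]. intros lam w _ _ s t. unfold g. rewrite ndist_refl. lra.
  - assert (HK1 : K0 < - omega) by (eapply Rle_lt_trans; [apply Rmax_l|exact HK]).
    assert (HLg : lip_const g < - omega) by (eapply Rle_lt_trans; [apply Rmax_r|exact HK]).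
    assert (Hgu := lipschitz_is_BUC g Hgb Hg).
    assert (Hhu := lipschitz_is_BUC h Hhb Hh).
    assert (Hku := lipschitz_is_BUC k Hkb Hk).
    apply (solution_of_approx_cauchy A omega g h k K0 L1 L2); try assumption.
    intros v. apply (approx_cauchy_closed A omega g h k K0 L1 L2); try assumption.
    intros eps Heps.
    (* Tameness is available for Lipschitz histories; the Cauchy property reaches [v] by
       closedness. *)
    destruct (lipschitz_dense_in_BUC v eps Heps) as (v' & (Lv & HLv0 & HLv) & Hv').
    exists v'; split; [|exact Hv'].
    apply (tame_history_cauchy A omega g h k K0 L1 L2); try assumption.
    destruct (lip_const_spec g Hg). destruct (lip_const_spec h Hh).
    destruct (lip_const_spec k Hk).
    apply (lipschitz_history_tame A omega g h k K0 L1 L2) with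
      (Lg := lip_const g) (Lh := lip_const h) (Lk := lip_const k) (Lv := Lv); assumption.
Qed.
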